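(* There exist a compact complex manifold $X$ of complex dimension $3$ and a holomorphic map $\varphi:X\to X$ such that the pullback $\varphi^*$ on de Rham cohomology does not respect the Hodge filtration strictly; i.e. for some $k$ and $p$, $$\varphi^*\big(F^pH^k_{dR}(X,\mathbb{C})\big)\neq F^pH^k_{dR}(X,\mathbb{C})\cap\varphi^*\big(H^k_{dR}(X,\mathbb{C})\big).$$
   Context: For a complex manifold $X$ with smooth $\mathbb{C}$-valued $(p,q)$-forms $\mathcal{A}_X^{p,q}$, the Hodge filtration $F^p H^k_{dR}(X,\mathbb{C})$ consists of those classes in $H_{dR}^k(X,\mathbb{C})$ which admit a $d$-closed representative in $\bigoplus_{r\ge p}\mathcal{A}_X^{r,k-r}$. A linear map of filtered vector spaces $\varphi:(V,F)\to(\widetilde V,\widetilde F)$ is called strict if $\varphi(F^p)=\widetilde F^p\cap\operatorname{im}\varphi$ for all $p$. *)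

(* Defs.v *)
From HB Require Import structures.
From mathcomp Require Import all_boot all_order all_algebra.
From mathcomp Require Import complex.
From mathcomp Require Import all_classical all_reals all_analysis.

Set Implicit Arguments.
Unset Strict Implicit.
Unset Printing Implicit Defensive.
Import Order.TTheory GRing.Theory Num.Theory.
Import numFieldNormedType.Exports.
Local Open Scope classical_set_scope.
Local Open Scope ring_scope.
Local Open Scope complex_scope.

(* The library puts the norm topology on R[i]^o only; this transfers it to R[i],
   in the way [numFieldNormedType] does it for abstract fields. *)
Section ComplexTopology.
Variable R : realType.
HB.instance Definition _ := NormedModule.copy R[i] R[i]^o.
End ComplexTopology.

Section RealCalculus.
Variables (R : realType) (n : nat).
Local Notation E := 'rV[R[i]]_n.

(* Directional derivatives of C-valued functions on C^n, seen as a REAL vector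
   space: the library's ['D_v] on ['rV[R[i]]_n] would take the limit of the
   difference quotient over a complex increment. *)
Definition rderivable (f : E -> R[i]) (x v : E) : Prop :=
  derivable (fun t : R => complex.Re (f (x + t%:C *: v))) 0 1 /\
  derivable (fun t : R => complex.Im (f (x + t%:C *: v))) 0 1.

Definition rderive (v : E) (f : E -> R[i]) (x : E) : R[i] :=
  derive1 (fun t : R => complex.Re (f (x + t%:C *: v))) 0 +i*
  derive1 (fun t : R => complex.Im (f (x + t%:C *: v))) 0.

Fixpoint Cn_on (m : nat) (U : set E) (f : E -> R[i]) : Prop :=
  (forall x, U x -> {for x, continuous f}) /\
  if m is m'.+1 then
    forall v, (forall x, U x -> rderivable f x v) /\ Cn_on m' U (rderive v f)
  else True.

Definition smooth_on (U : set E) (f : E -> R[i]) := forall m, Cn_on m U f.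

Definition real_multilinear k (w : ('I_k -> E) -> R[i]) : Prop :=
  forall (v : 'I_k -> E) (a : 'I_k) (c : R) (y z : E),
    w [eta v with a |-> c%:C *: y + z] =
    c%:C * w [eta v with a |-> y] + w [eta v with a |-> z].

Definition alternating k (w : ('I_k -> E) -> R[i]) : Prop :=
  forall (v : 'I_k -> E) (a b : 'I_k), a != b -> v a = v b -> w v = 0.

(* A k-form in a chart is a function of the point and of k tangent vectors. *)
Definition ext_deriv k (w : E -> ('I_k -> E) -> R[i])
    (x : E) (v : 'I_k.+1 -> E) : R[i] :=
  \sum_(a < k.+1)
    (-1) ^+ a * rderive (v a) (fun y => w y (fun b => v (lift a b))) x.

(* For r <= k, the constant form
     dz_(I 0) /\ ... /\ dz_(I (r-1)) /\ dzbar_(I r) /\ ... /\ dzbar_(I (k-1)). *)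
Definition wedge_dz_dzbar k (r : nat) (I : {ffun 'I_k -> 'I_n})
    (v : 'I_k -> E) : R[i] :=
  \det (\matrix_(a < k, b < k)
          if (a < r)%N then v b 0 (I a) else (v b 0 (I a))^*).

Definition has_type k (r : nat) (w : ('I_k -> E) -> R[i]) : Prop :=
  exists c : {ffun 'I_k -> 'I_n} -> R[i],
    forall v, w v = \sum_I c I * wedge_dz_dzbar r I v.

End RealCalculus.

(* The values of [to_chart i] off [dom i] and of [of_chart i] off [cod i] are
   irrelevant.  Manifolds are not required to be connected. *)
Record complex_manifold (R : realType) (n : nat) := ComplexManifold {
  carrier :> topologicalType;
  manifold_hausdorff : hausdorff_space carrier;
  manifold_second_countable : @second_countable carrier;
  chart_index : Type;
  dom : chart_index -> set carrier;
  cod : chart_index -> set 'rV[R[i]]_n;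
  to_chart : chart_index -> carrier -> 'rV[R[i]]_n;
  of_chart : chart_index -> 'rV[R[i]]_n -> carrier;
  dom_open : forall i, open (dom i);
  cod_open : forall i, open (cod i);
  to_chart_cod : forall i p, dom i p -> cod i (to_chart i p);
  of_chart_dom : forall i x, cod i x -> dom i (of_chart i x);
  to_chartK : forall i p, dom i p -> of_chart i (to_chart i p) = p;
  of_chartK : forall i x, cod i x -> to_chart i (of_chart i x) = x;
  to_chart_continuous :
    forall i p, dom i p -> {for p, continuous (to_chart i)};
  of_chart_continuous :
    forall i x, cod i x -> {for x, continuous (of_chart i)};
  chart_at : carrier -> chart_index;
  mem_chart_at : forall p, dom (chart_at p) p;
  transition_holomorphic : forall i j x, cod i x -> dom j (of_chart i x) ->
    differentiable (to_chart j \o of_chart i) x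
}.

Arguments chart_index {R n} _.
Arguments chart_at {R n} _ _.

Section Manifold.
Variables (R : realType) (n : nat).
Local Notation E := 'rV[R[i]]_n.

Definition holomorphic (X Y : complex_manifold R n) (f : X -> Y) : Prop :=
  continuous f /\
  forall (i : chart_index X) (j : chart_index Y) (x : E),
    cod i x -> dom j (f (of_chart i x)) ->
    differentiable (to_chart j \o f \o of_chart i) x.

(* A form is given by its expressions in all charts; two preforms represent
   the same form when they agree on every [cod i]. *)
Definition preform (X : complex_manifold R n) (k : nat) :=
  chart_index X -> E -> ('I_k -> E) -> R[i].

Definition smooth_form (X : complex_manifold R n) k (w : preform X k) : Prop :=
  [/\ forall i x, cod i x -> real_multilinear (w i x),
      forall i x, cod i x -> alternating (w i x),
      forall i v, smooth_on (cod i) (fun x => w i x v) &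
      forall i j x v, cod i x -> dom j (of_chart i x) ->
        w i x v = w j (to_chart j (of_chart i x))
          (fun a => 'd (to_chart j \o of_chart i) x (v a))].

Definition closed_form (X : complex_manifold R n) k (w : preform X k) : Prop :=
  smooth_form w /\ forall i x v, cod i x -> ext_deriv (w i) x v = 0.

Definition exact_form (X : complex_manifold R n) k : preform X k -> Prop :=
  match k with
  | 0 => fun w => forall i x v, cod i x -> w i x v = 0
  | k'.+1 => fun w => exists2 t : preform X k', smooth_form t &
      forall i x v, cod i x -> w i x v = ext_deriv (t i) x v
  end.

Definition dR_class (X : complex_manifold R n) k (w : preform X k) :
    set (preform X k) :=
  [set e | closed_form e /\ exact_form (fun i x v => e i x v - w i x v)].

Definition dR_cohomology (X : complex_manifold R n) k :
    set (set (preform X k)) :=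
  [set dR_class w | w in @closed_form X k].

Definition pq_form (X : complex_manifold R n) k (r : nat) (w : preform X k) :=
  smooth_form w /\ forall i x, cod i x -> has_type r (w i x).

(* Smooth sections of the sum of the A^(r, k - r) over p <= r <= k. *)
Definition filtered_form (X : complex_manifold R n) (p k : nat)
    (w : preform X k) : Prop :=
  exists2 t : nat -> preform X k,
    forall r, (p <= r <= k)%N -> pq_form r (t r) &
    forall i x v, cod i x -> w i x v = \sum_(p <= r < k.+1) t r i x v.

Definition hodge_filtration (X : complex_manifold R n) (p k : nat) :
    set (set (preform X k)) :=
  [set dR_class w | w in [set w | closed_form w /\ filtered_form p w]].

Definition pullback_form (X Y : complex_manifold R n) (f : X -> Y) k
    (w : preform Y k) : preform X k :=
  fun i x v =>
    let j := chart_at Y (f (of_chart i x)) in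
    w j (to_chart j (f (of_chart i x)))
      (fun a => 'd (to_chart j \o f \o of_chart i) x (v a)).

(* [f^* [w] = [f^* w]], written as the union of the classes [[f^* w]] over all
   representatives [w]. *)
Definition pullback_dR (X Y : complex_manifold R n) (f : X -> Y) k
    (c : set (preform Y k)) : set (preform X k) :=
  \bigcup_(w in c) dR_class (pullback_form f w).

End Manifold.

Arguments dR_cohomology {R n} X k.
Arguments hodge_filtration {R n} X p k.
Arguments pullback_dR {R n X Y} f k c.

(* Main.v *)
From HB Require Import structures.
Require Import Defs.
From mathcomp Require Import all_boot all_order all_algebra.
From mathcomp Require Import complex.
From mathcomp Require Import all_classical all_reals all_analysis.
From mathcomp Require Import ring.

(** The threefold is a nilmanifold X = C^3 / Gamma, where Gamma consists of the
    affine maps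
      (z_0, z_1, z_2) |-> (z_0 + a, z_1 + Re a z_0 + b, z_2 + Re a z_1 + Re b z_0 + c)
    for Gaussian integers a, b, c, and phi is induced by z |-> (0, z_0, i z_0).
    The class witnessing the failure of strictness lives in degree k = 1, with p = 1.

    The real functions u_1 = Re z_1 - (Re z_0)^2 / 2 and
    u_2 = Re z_2 - Re z_0 Re z_1 + (Re z_0)^3 / 3 change by constants under Gamma,
    so eta = d(u_1 - i u_2) is a closed form on X, and phi^* eta = dz_0 is of type
    (1, 0).  Suppose that [dz_0] = phi^* [theta] with theta closed of type (1, 0).
    On C^3 one has theta = dF with F holomorphic, and the periods of F define a
    homomorphism rho : Gamma -> C.  Comparing with dz_0 gives rho (0, 1, i) = 1,
    whereas rho (0, i, 0) = rho (0, 0, i) = 0, because these two translations are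
    commutators; hence rho (0, 1, 0) = 1.  The entire function g (t) = F (0, t, 0)
    then satisfies g (t + 1) = g (t) + 1 and g (t + i) = g (t).  This is impossible:
    by the Cauchy-Riemann equations the average of Re g over a vertical period is
    constant, yet it increases by 1 along a horizontal one. *)

Set Implicit Arguments.
Unset Strict Implicit.
Unset Printing Implicit Defensive.
Import Order.TTheory GRing.Theory Num.Theory.
Import numFieldNormedType.Exports.
Local Open Scope classical_set_scope.
Local Open Scope ring_scope.
Local Open Scope complex_scope.

Local Notation Re := (@complex.Re _).
Local Notation Im := (@complex.Im _).

(** * Topology of C^n *)

Section ComplexPlane.
Variable R : realType.
Implicit Types z w : R[i].

Lemma cReD z w : Re (z + w) = Re z + Re w.
Proof. by case: z w => [? ?] [? ?]. Qed.

Lemma cImD z w : Im (z + w) = Im z + Im w.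
Proof. by case: z w => [? ?] [? ?]. Qed.

Lemma cReB z w : Re (z - w) = Re z - Re w.
Proof. by case: z w => [? ?] [? ?]. Qed.

Lemma cImB z w : Im (z - w) = Im z - Im w.
Proof. by case: z w => [? ?] [? ?]. Qed.

Lemma RRe_pos z : 0 < z -> (Re z)%:C = z.
Proof. by move=> /gtr0_real/RRe_real. Qed.

Lemma Re_gt0 z : 0 < z -> 0 < Re z.
Proof. by rewrite ltcE => /andP[]. Qed.

Lemma normc_ge_Im z : `|Im z|%:C <= `|z|.
Proof.
have := normc_ge_Re (z * 'i); rewrite ReiNIm normrN.
by rewrite normrM (_ : `|'i| = 1) ?mulr1// normc_def/= expr0n/= expr1n add0r sqrtr1.
Qed.

Lemma normc_le_ReIm z : `|z| <= (`|Re z| + `|Im z|)%:C.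
Proof.
case: z => a b.
have i1 : `|'i : R[i]| = 1 by rewrite normc_def/= expr0n/= expr1n add0r sqrtr1.
have {1}-> : a +i* b = a%:C + b%:C * 'i by simpc.
rewrite (le_trans (ler_normD _ _))// normrM i1 mulr1 !normc_def/= expr0n/= !addr0.
by rewrite !sqrtr_sqr -rmorphD.
Qed.

Lemma Re_continuous : continuous (Re : R[i] -> R).
Proof.
move=> z; apply/(@cvgrPdist_lt _ _ _ _ (nbhs_filter z)) => e e0.
apply/nbhs_ballP; exists e%:C => /=.
  by rewrite ltcR.
move=> w; rewrite -ball_normE/= => zw.
have := le_lt_trans (normc_ge_Re (z - w)) zw; rewrite ltcR cReB; exact.
Qed.

Lemma Im_continuous : continuous (Im : R[i] -> R).
Proof.
move=> z; apply/(@cvgrPdist_lt _ _ _ _ (nbhs_filter z)) => e e0.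
apply/nbhs_ballP; exists e%:C => /=.
  by rewrite ltcR.
move=> w; rewrite -ball_normE/= => zw.
have := le_lt_trans (normc_ge_Im (z - w)) zw; rewrite ltcR cImB; exact.
Qed.

Lemma cvg_complex (T : Type) (F : set_system T) (FF : Filter F) (f : T -> R[i]) z :
  Re (f t) @[t --> F] --> Re z ->
  Im (f t) @[t --> F] --> Im z -> f @ F --> z.
Proof.
move=> fr fi; apply/cvgrPdist_lt => e e0.
have e20 : 0 < Re e / 2 by rewrite divr_gt0// Re_gt0.
move/cvgrPdist_lt/(_ _ e20) : fr => fr.
move/cvgrPdist_lt/(_ _ e20) : fi => fi.
near=> t.
apply: (le_lt_trans (normc_le_ReIm _)); rewrite -(RRe_pos e0) ltcR.
by rewrite cReB cImB [ltRHS]splitr ltrD//; near: t.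
Unshelve. all: by end_near. Qed.

Lemma continuous_complex (T : topologicalType) (f : T -> R[i]) t :
  {for t, continuous (Re \o f)} -> {for t, continuous (Im \o f)} ->
  {for t, continuous f}.
Proof. by move=> fr fi; apply: cvg_complex. Qed.

Lemma real_complex_continuous : continuous (real_complex R).
Proof. by move=> x; apply: continuous_complex => /=; [exact: cvg_id|exact: cvg_cst]. Qed.

(** A product of three such squares will be shown to map onto the nilmanifold, which gives its
    compactness. *)
Lemma unit_square_compact :
  compact [set z : R[i] | 0 <= Re z <= 1 /\ 0 <= Im z <= 1].
Proof.
have -> : [set z : R[i] | 0 <= Re z <= 1 /\ 0 <= Im z <= 1] =
    (fun p => p.1 +i* p.2) @` (`[0, 1]%classic `*` `[0, 1]%classic : set (R * R)).
  apply/seteqP; split => [[a b]/= [ha hb]|_ [[a b] /= [ha hb] <-]/=].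
    by exists (a, b) => //=; rewrite !in_itv/=.
  by move: ha hb; rewrite !in_itv/=.
apply: continuous_compact; last by apply: compact_setX; exact: segment_compact.
apply: continuous_subspaceT => p; apply: continuous_complex => /=.
  exact: cvg_fst.
exact: cvg_snd.
Qed.

Lemma rV_continuous (T : topologicalType) n (f : T -> 'rV[R[i]]_n) t :
  (forall j, {for t, continuous (fun s => f s 0 j)}) -> {for t, continuous f}.
Proof.
move=> fc; apply/cvg_ballP => e e0.
have h j : \forall s \near t, ball (f t 0 j) e (f s 0 j).
  by move: (fc j); move/cvg_ballP; exact.
near=> s; split => // i j; rewrite ord1; move: j; near: s.
exact: filter_forall.
Unshelve. all: by end_near. Qed.

(** The base consists of the balls with Gaussian rational centres and radii [1/(k+1)]. *)
Lemma rV_second_countable n : @second_countable 'rV[R[i]]_n.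
Proof.
pose c (p : 'rV[rat * rat]_n) : 'rV[R[i]]_n :=
  \row_j (ratr (p 0 j).1 +i* ratr (p 0 j).2).
pose B (q : 'rV[rat * rat]_n * nat) := (ball (c q.1) (q.2.+1%:R^-1)).
exists (range B).
  by apply: (card_le_trans (card_image_le _ _)); exact: countableP.
split.
  move=> _ [q _ <-]; exact: ball_open.
move=> x V /nbhs_ballP[e /= e0 xeV].
(* A radius below half of [Re e] keeps a ball that contains [x] inside the ball of radius [e] about
   [x]. The positive element [e] of [R[i]] is real, so [Re e] carries all of it. *)
have [k ke] : exists k, k.+1%:R^-1 < Re e / 2.
  have e20 : 0 < Re e / 2 by rewrite divr_gt0// Re_gt0.
  have /ltr_add_invr[k] : 0 < Re e / 2 by [].
  by rewrite add0r => ?; exists k.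
have k0 : 0 < k.+1%:R^-1 :> R by rewrite invr_gt0.
have dn (a : R) : exists q : rat, `|a - ratr q| < k.+1%:R^-1 / 2.
  have /rat_in_itvoo[q] : a - k.+1%:R^-1 / 2 < a + k.+1%:R^-1 / 2.
    by rewrite ltrBlDr -addrA -splitr ltrDl.
  rewrite in_itv/= => /andP[h1 h2]; exists q; rewrite ltr_distl.
  by rewrite ltrBlDr h2 -ltrBlDr h1.
have [p1 p1x] := choice (fun j => dn (Re (x 0 j))).
have [p2 p2x] := choice (fun j => dn (Im (x 0 j))).
have kC : k.+1%:R^-1 = (k.+1%:R^-1)%:C :> R[i] by rewrite fmorphV/= rmorph_nat.
have xc : ball x (k.+1%:R^-1) (c (\row_j (p1 j, p2 j))).
  rewrite /ball/=; split; first by rewrite invr_gt0.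
  move=> i j; rewrite ord1 -ball_normE/= !mxE /= kC.
  apply: (le_lt_trans (normc_le_ReIm _)); rewrite ltcR [ltRHS]splitr.
  have := p1x j; have := p2x j.
  by case: (x 0 j) => a b /= ? ?; rewrite ltrD.
exists (B (\row_j (p1 j, p2 j), k)).
  by split; [exists (\row_j (p1 j, p2 j), k)|exact: ball_sym].
move=> y By; apply: xeV.
have -> : e = (Re e / 2)%:C + (Re e / 2)%:C.
  by rewrite -rmorphD/= -splitr RRe_pos.
have kle : k.+1%:R^-1 <= (Re e / 2)%:C by rewrite kC lecR ltW.
apply: (ball_triangle (le_ball kle xc)).
exact: le_ball kle _ By.
Qed.

End ComplexPlane.

(** * Calculus along real lines *)

Section UnitIntervalIntegral.
Variable R : realType.
Local Notation mu := (@lebesgue_measure R).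

Lemma integrable01 (f : R -> R) : continuous f -> mu.-integrable `[0, 1] (EFin \o f).
Proof.
move=> fc; apply: continuous_compact_integrable; first exact: segment_compact.
exact: continuous_subspaceT.
Qed.

Lemma Rintegral01_FTC (f F : R -> R) :
  (forall t, is_derive t (1 : R) F (f t)) -> continuous f ->
  \int[mu]_(t in `[0, 1]) f t = F 1 - F 0.
Proof.
move=> dF fc.
have Fd t : derivable F t 1 by case: (dF t).
have Fc : continuous F.
  by move=> t; apply/differentiable_continuous/derivable1_diffP.
rewrite /Rintegral (@continuous_FTC2 _ f F 0 1) ?ltr01 -?EFinB//.
- exact: continuous_subspaceT.
- by split=> //; [apply: cvg_at_right_filter|apply: cvg_at_left_filter]; exact: Fc.
- by move=> t _; rewrite derive1E; case: (dF t).
Qed.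

(** Differentiation under the integral sign by domination: the continuous [f'] is bounded on the
    compact rectangle [[s - 1, s + 1]] times [[0, 1]], and a constant dominates. *)
Lemma is_derive_Rintegral01 (f f' : R -> R -> R) s :
  (forall s t, is_derive s (1 : R) (f ^~ t) (f' s t)) ->
  (forall s, continuous (f s)) ->
  continuous (fun p : R * R => f' p.1 p.2) ->
  is_derive s (1 : R) (fun s => \int[mu]_(t in `[0, 1]) f s t)
                      (\int[mu]_(t in `[0, 1]) f' s t).
Proof.
move=> df fc f'c.
have cK : compact (`[s - 1, s + 1]%classic `*` `[0, 1]%classic : set (R * R)).
  by apply: compact_setX; exact: segment_compact.
have /compact_bounded[M [_ f'M]] :=
  continuous_compact (continuous_subspaceT f'c) cK.
have f'E t s' : partial1of2 f s' t = f' s' t.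
  by rewrite partial1of2E; case: (df s' t).
(* [f'M] provides the bound for every real strictly above [M], hence the added 1; the absolute value
   makes the constant nonnegative. *)
pose C := `|M| + 1.
have Cub s' t : `]s - 1, s + 1[%classic s' -> `[0, 1]%classic t ->
    `|partial1of2 f s' t| <= cst C t.
  move=> s'I tI; rewrite f'E; apply: f'M; first by rewrite /C ltr_pwDr// ler_norm.
  by exists (s', t) => //; split => //=; exact: subset_itv_oo_cc.
have sI : `]s - 1, s + 1[%classic s by rewrite /= in_itv/= ltrBlDr ltrDl ltr01.
have intf s' : `]s - 1, s + 1[%classic s' -> mu.-integrable `[0, 1] (EFin \o f s').
  by move=> _; exact: integrable01.
have derf s' t : `]s - 1, s + 1[%classic s' -> `[0, 1]%classic t ->
    derivable (f ^~ t) s' 1.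
  by move=> _ _; case: (df s' t).
have C0 (t : measurableTypeR R) : 0 <= cst C t by rewrite addr_ge0.
have intC : mu.-integrable `[0, 1] (EFin \o cst C).
  by apply: integrable01; exact: cst_continuous.
have mI : measurable (`[0, 1]%classic : set R) by [].
apply: DeriveDef.
  exact: (@derivable_under_integral R _ (measurableTypeR R) mu f _ mI s _ _
    sI intf derf _ C0 intC Cub).
rewrite -derive1E (@differentiation_under_integral R _ (measurableTypeR R) mu f
  _ mI s _ _ sI intf derf _ C0 intC Cub).
by apply: eq_Rintegral => t _; rewrite f'E.
Qed.

End UnitIntervalIntegral.

(** * Derivatives along real lines and the homotopy formula *)

Section RealLines.
Variables (R : realType) (n : nat).
Local Notation E := 'rV[R[i]]_n.
Local Notation mu := (@lebesgue_measure R).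

Definition line_derive (p : E -> R) (x v : E) (d : R) :=
  is_derive (0 : R) (1 : R) (fun t : R => p (x + t%:C *: v)) d.

Lemma line_continuous (x v : E) : continuous (fun t : R => x + t%:C *: v).
Proof.
move=> t; apply: cvgD; first exact: cvg_cst.
by apply: cvgZr_tmp; exact: real_complex_continuous.
Qed.

Lemma line_deriveP (p : E -> R) (x v : E) (s d : R) :
  line_derive p (x + s%:C *: v) v d ->
  is_derive s (1 : R) (fun t : R => p (x + t%:C *: v)) d.
Proof.
move=> h.
rewrite (_ : (fun t => _) =
  (fun t : R => p (x + s%:C *: v + t%:C *: v)) \o (fun t => t - s)); last first.
  apply/funext => t /=; congr p; rewrite -addrA -scalerDl -rmorphD/=.
  by rewrite (addrC s) subrK.
rewrite -[d]mulr1; apply: is_derive1_comp; first by rewrite subrr.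
exact: is_derive_shift.
Qed.

Lemma line_derive_eq0 (p : E -> R) (x y : E) :
  (forall z v, line_derive p z v 0) -> p x = p y.
Proof.
move=> p0.
have := @is_derive_0_is_cst R (fun t : R => p (x + t%:C *: (y - x))) 0 1.
by rewrite scale0r scale1r addr0 (addrC x (y - x)) subrK; apply => t; exact: line_deriveP.
Qed.

(** The homotopy formula for a real one-form [p], with [q x u w] its derivative in the direction
    [u]; symmetry of [q] is closedness. It turns the derivative of the integrand into a total
    derivative in [t]. *)
Lemma poincare_line (p : E -> E -> R) (q : E -> E -> E -> R) (z v : E) :
  (forall x u w, line_derive (p ^~ w) x u (q x u w)) ->
  (forall x t u w, p x (t%:C *: u + w) = t * p x u + p x w) ->
  (forall x u w, q x u w = q x w u) ->
  (forall w, continuous (p ^~ w)) ->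
  (forall u w, continuous (fun x => q x u w)) ->
  line_derive (fun y => \int[mu]_(t in `[0, 1]) p (t%:C *: y) y) z v (p z v).
Proof.
move=> dp plin qC pc qc.
have p1 (x y : E) (s : R) : p x (y + s%:C *: v) = p x y + s * p x v.
  by rewrite addrC plin addrC.
(* [a s t] is the point t (z + s v), [f] is the integrand expanded by linearity of the form, and
   [f'] is its derivative in [s]. *)
pose a (s t : R) := t%:C *: z + (t * s)%:C *: v.
pose f s t := p (a s t) z + s * p (a s t) v.
pose f' s t := t * q (a s t) v z + (p (a s t) v + s * (t * q (a s t) v v)).
rewrite /line_derive.
have -> : (fun s : R => \int[mu]_(t in `[0, 1])
      p (t%:C *: (z + s%:C *: v)) (z + s%:C *: v)) =
    (fun s => \int[mu]_(t in `[0, 1]) f s t).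
  apply/funext => s; apply: eq_Rintegral => t _.
  by rewrite p1 /f /a scalerDr scalerA -rmorphM.
have ac : continuous (fun st : R * R => a st.1 st.2).
  move=> st; apply: cvgD; apply: cvgZr_tmp; apply: continuous_cvg.
  - exact: real_complex_continuous.
  - exact: cvg_snd.
  - exact: real_complex_continuous.
  - by apply: cvgM; [exact: cvg_snd|exact: cvg_fst].
have da w s t : is_derive s (1 : R) (fun s => p (a s t) w) (t * q (a s t) v w).
  rewrite (_ : (fun s => _) =
    (fun r : R => p (t%:C *: z + r%:C *: v) w) \o (fun s => t * s))//.
  rewrite mulrC; apply: is_derive1_comp.
    exact: (@line_deriveP (p ^~ w) (t%:C *: z) v (t * s) _ (dp _ _ _)).
  by apply: is_derive_eq; exact: mulr1.
have qac u w : continuous (fun st : R * R => q (a st.1 st.2) u w).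
  move=> st; exact: (continuous_comp (ac st) (qc u w _)).
have pac w : continuous (fun st : R * R => p (a st.1 st.2) w).
  move=> st; exact: (continuous_comp (ac st) (pc w _)).
have fc : continuous (fun st : R * R => f st.1 st.2).
  move=> st; apply: cvgD; first exact: pac.
  by apply: cvgM; [exact: cvg_fst|exact: pac].
have f'c : continuous (fun st : R * R => f' st.1 st.2).
  move=> st; apply: cvgD; first by apply: cvgM; [exact: cvg_snd|exact: qac].
  apply: cvgD; first exact: pac.
  by apply: cvgM; [exact: cvg_fst|apply: cvgM; [exact: cvg_snd|exact: qac]].
have pairc (s : R) : continuous (fun t : R => (s, t)).
  move=> t; apply: (@cvg_pair _ _ _ _ (nbhs s) (nbhs t) _ _ _ (fun=> s) id).
    exact: cvg_cst.
  exact: cvg_id.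
(* By the symmetry of [q], the integrand at s = 0 is the derivative in [t] of t p(tz)(v), whose
   values at 0 and 1 are 0 and [p z v]. *)
have -> : p z v = \int[mu]_(t in `[0, 1]) f' 0 t.
  have dF t : is_derive t (1 : R) (fun t : R => t * p (t%:C *: z) v) (f' 0 t).
    rewrite /f' /a mulr0 scale0r addr0 mul0r addr0.
    have h : is_derive t (1 : R) (fun t : R => p (t%:C *: z) v) (q (t%:C *: z) z v).
      have := @line_deriveP (p ^~ v) 0 z t _ (dp _ _ _).
      by under eq_fun do rewrite add0r; rewrite add0r.
    apply: is_derive_eq; rewrite [q _ v z]qC; congr (_ + _); exact: mulr1.
  rewrite (Rintegral01_FTC dF); first by rewrite mul1r mul0r subr0 scale1r.
  by move=> t; exact: (continuous_comp (pairc 0 t) (f'c _)).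
apply: is_derive_Rintegral01.
- move=> s t; rewrite /f /f'.
  have h1 := da z s t; have h2 := da v s t.
  apply: is_derive_eq; congr (_ + _); rewrite addrC; congr (_ + _); exact: mulr1.
- by move=> s t; exact: (continuous_comp (pairc s t) (fc _)).
- exact: f'c.
Qed.

End RealLines.

(** * Rules for real directional derivatives and smoothness on C^n *)

Section RealDerivatives.
Variables (R : realType) (n : nat).
Local Notation E := 'rV[R[i]]_n.
Implicit Types (f g : E -> R[i]) (x v : E) (U : set E).

Definition is_rderive f x v (d : R[i]) :=
  line_derive (fun z => Re (f z)) x v (Re d) /\
  line_derive (fun z => Im (f z)) x v (Im d).

Lemma rderivableP f x v : rderivable f x v -> is_rderive f x v (rderive v f x).
Proof.
move=> [/derivableP h1 /derivableP h2]; rewrite -!derive1E in h1 h2.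
by split; [exact: h1|exact: h2].
Qed.

Lemma is_rderive_rderivable f x v d : is_rderive f x v d -> rderivable f x v.
Proof. by move=> [[? _] [? _]]; split. Qed.

Lemma is_rderiveE f x v d : is_rderive f x v d -> rderive v f x = d.
Proof.
move=> [[_ h1] [_ h2]]; apply/eqP; rewrite eq_complex /rderive/= !derive1E.
by rewrite h1 h2 !eqxx.
Qed.

Lemma is_rderive_cst (c : R[i]) x v : is_rderive (fun=> c) x v 0.
Proof. by split; exact: is_derive_cst. Qed.

Lemma is_rderiveD f g x v d e : is_rderive f x v d -> is_rderive g x v e ->
  is_rderive (fun z => f z + g z) x v (d + e).
Proof.
move=> [f1 f2] [g1 g2]; split.
  by rewrite cReD /line_derive; under eq_fun do rewrite cReD; exact: is_deriveD.
by rewrite cImD /line_derive; under eq_fun do rewrite cImD; exact: is_deriveD.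
Qed.

Lemma cReM (z w : R[i]) : Re (z * w) = Re z * Re w - Im z * Im w.
Proof. by case: z w => [? ?] [? ?]. Qed.

Lemma cImM (z w : R[i]) : Im (z * w) = Re z * Im w + Im z * Re w.
Proof. by case: z w => [? ?] [? ?]. Qed.

Lemma is_rderiveM f g x v d e : is_rderive f x v d -> is_rderive g x v e ->
  is_rderive (fun z => f z * g z) x v (d * g x + f x * e).
Proof.
have x0 : x + (0 : R)%:C *: v = x by rewrite scale0r addr0.
move=> [f1 f2] [g1 g2]; rewrite /is_rderive /line_derive in f1 f2 g1 g2 *; split.
  under eq_fun do rewrite cReM.
  apply: is_derive_eq; rewrite cReD !cReM x0 /GRing.scale/=; ring.
under eq_fun do rewrite cImM.
apply: is_derive_eq; rewrite cImD !cImM x0 /GRing.scale/=; ring.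
Qed.

Lemma is_rderive_linear f x v :
  (forall y t w, f (y + t%:C *: w) = f y + t%:C * f w) -> is_rderive f x v (f v).
Proof.
move=> flin; split; rewrite /line_derive.
  under eq_fun do rewrite flin cReD cReM/= mul0r subr0.
  apply: is_derive_eq; rewrite /GRing.scale/=; ring.
under eq_fun do rewrite flin cImD cImM/= mul0r addr0.
apply: is_derive_eq; rewrite /GRing.scale/=; ring.
Qed.

Lemma is_rderive_affine (A L : E -> E) f x v d :
  (forall y t w, A (y + t%:C *: w) = A y + t%:C *: L w) ->
  is_rderive f (A x) (L v) d -> is_rderive (f \o A) x v d.
Proof.
move=> AL [h1 h2]; split; rewrite /line_derive /=.
  by under eq_fun do rewrite AL.
by under eq_fun do rewrite AL.
Qed.

Lemma line_near x v (P : set E) :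
  (\forall z \near x, P z) -> \forall t \near (0 : R), P (x + t%:C *: v).
Proof.
by move=> Px; apply: (@line_continuous R n x v 0); rewrite /= scale0r addr0.
Qed.

Lemma near_is_rderive f g x v d :
  (\forall z \near x, f z = g z) -> is_rderive f x v d -> is_rderive g x v d.
Proof.
move=> /(@line_near _ v) fg [h1 h2]; split.
  by apply: near_eq_is_derive h1; apply: filterS fg => t ->.
by apply: near_eq_is_derive h2; apply: filterS fg => t ->.
Qed.

Lemma Cn_on_subset m U V f : U `<=` V -> Cn_on m V f -> Cn_on m U f.
Proof.
move=> UV; elim: m f => [|m IH] f [fc] fd; split; try by move=> x /UV/fc.
  by [].
move=> v; have [h1 h2] := fd v; split; last exact: IH.
by move=> x /UV/h1.
Qed.

Lemma Cn_onW m U f : Cn_on m.+1 U f -> Cn_on m U f.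
Proof.
elim: m f => [|m IH] f [fc fd]; split => //.
by move=> v; have [h1 h2] := fd v; split => //; exact: IH.
Qed.

Lemma smooth_on_subset U V f : U `<=` V -> smooth_on V f -> smooth_on U f.
Proof. by move=> UV h m; exact: Cn_on_subset UV (h m). Qed.

Lemma smooth_on_rderivable U f x v : smooth_on U f -> U x -> rderivable f x v.
Proof. by move=> /(_ 1%N)[_ /(_ v)[h _]]; exact: h. Qed.

Lemma smooth_on_rderive U f v : smooth_on U f -> smooth_on U (rderive v f).
Proof. by move=> h m; have [_ /(_ v)[]] := h m.+1. Qed.

Lemma smooth_on_continuous U f x : smooth_on U f -> U x -> {for x, continuous f}.
Proof. by move=> /(_ 0%N)[h _]; exact: h. Qed.


(** Serves the lift of a form, which agrees with a single chart expression only near each point. A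
    derivative at a point depends on nearby values alone, so the derivatives of the local models are
    local models of the derivative. *)
Lemma Cn_on_local m f : (forall x, exists U g,
    [/\ open U, U x, {in U, f =1 g} & Cn_on m U g]) -> Cn_on m setT f.
Proof.
elim: m f => [|m IH] f floc; split => //.
- move=> x _; have [U [g [oU Ux fg [gc _]]]] := floc x.
  have fgx : \forall z \near x, g z = f z.
    by near=> z; rewrite fg// inE; near: z; exact: open_nbhs_nbhs.
  rewrite /prop_for/continuous_at fg ?inE//.
  exact: cvg_trans (near_eq_cvg fgx) (gc x Ux).
- move=> x _; have [U [g [oU Ux fg [gc _]]]] := floc x.
  have fgx : \forall z \near x, g z = f z.
    by near=> z; rewrite fg// inE; near: z; exact: open_nbhs_nbhs.
  rewrite /prop_for/continuous_at fg ?inE//.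
  exact: cvg_trans (near_eq_cvg fgx) (gc x Ux).
move=> v; have dfg x U g : open U -> U x -> {in U, f =1 g} -> Cn_on m.+1 U g ->
    is_rderive f x v (rderive v g x).
  move=> oU Ux fg [_ /(_ v)[gd _]].
  apply: near_is_rderive (rderivableP (gd x Ux)).
  by near=> z; rewrite fg// inE; near: z; exact: open_nbhs_nbhs.
split=> [x _|].
  have [U [g [oU Ux fg gs]]] := floc x.
  exact: is_rderive_rderivable (dfg x U g oU Ux fg gs).
apply: IH => x; have [U [g [oU Ux fg gs]]] := floc x.
exists U, (rderive v g); split => //.
  by move=> z /[!inE] Uz; exact/is_rderiveE/(dfg z U g).
by have [_ /(_ v)[]] := gs.
Unshelve. all: by end_near. Qed.

Lemma smooth_local f : (forall x, exists U g,
    [/\ open U, U x, {in U, f =1 g} & smooth_on U g]) -> smooth_on setT f.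
Proof.
move=> h m; apply: Cn_on_local => x; have [U [g [? ? ? ?]]] := h x.
by exists U, g; split.
Qed.

Lemma smooth_cst (c : R[i]) : smooth_on setT (fun _ : E => c).
Proof.
move=> m; elim: m c => [|m IH] c; split => //; try by move=> x _; exact: cst_continuous.
move=> v; split=> [x _|]; first exact: is_rderive_rderivable (is_rderive_cst _ _ _).
rewrite (_ : rderive v _ = fun=> 0)//.
by apply/funext => x; exact/is_rderiveE/is_rderive_cst.
Qed.

Lemma Cn_onD m f g :
  Cn_on m setT f -> Cn_on m setT g -> Cn_on m setT (fun z => f z + g z).
Proof.
elim: m f g => [|m IH] f g [fc fd] [gc gd].
  by split=> [x xT|//]; exact: (cvgD (fc x xT) (gc x xT)).
split=> [x xT|v]; first exact: (cvgD (fc x xT) (gc x xT)).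
have [f1 f2] := fd v; have [g1 g2] := gd v.
have h x : is_rderive (fun z => f z + g z) x v (rderive v f x + rderive v g x).
  by apply: is_rderiveD; apply: rderivableP; [exact: f1|exact: g1].
split=> [x _|]; first exact: is_rderive_rderivable (h x).
rewrite (_ : rderive v _ = fun x => rderive v f x + rderive v g x); first exact: IH.
by apply/funext => x; exact/is_rderiveE.
Qed.

Lemma Cn_onM m f g :
  Cn_on m setT f -> Cn_on m setT g -> Cn_on m setT (fun z => f z * g z).
Proof.
elim: m f g => [|m IH] f g fs gs; have [fc fd] := fs; have [gc gd] := gs.
  by split=> [x xT|//]; exact: (cvgM (fc x xT) (gc x xT)).
split=> [x xT|v]; first exact: (cvgM (fc x xT) (gc x xT)).
have [f1 f2] := fd v; have [g1 g2] := gd v.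
have h x : is_rderive (fun z => f z * g z) x v
    (rderive v f x * g x + f x * rderive v g x).
  by apply: is_rderiveM; apply: rderivableP; [exact: f1|exact: g1].
split=> [x _|]; first exact: is_rderive_rderivable (h x).
rewrite (_ : rderive v _ = fun x => rderive v f x * g x + f x * rderive v g x).
  by apply: Cn_onD; apply: IH => //; exact: Cn_onW.
by apply/funext => x; exact/is_rderiveE.
Qed.

Lemma smoothD f g : smooth_on setT f -> smooth_on setT g ->
  smooth_on setT (fun z => f z + g z).
Proof. by move=> fs gs m; exact: Cn_onD. Qed.

Lemma smoothM f g : smooth_on setT f -> smooth_on setT g ->
  smooth_on setT (fun z => f z * g z).
Proof. by move=> fs gs m; exact: Cn_onM. Qed.

(** The derivative in the direction [v] is the constant [f v]. *)
Lemma smooth_linear f : continuous f ->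
  (forall y t w, f (y + t%:C *: w) = f y + t%:C * f w) -> smooth_on setT f.
Proof.
move=> fc flin [|m]; first by split=> [x _|//]; exact: fc.
split=> [x _|v]; first exact: fc.
split=> [x _|].
  exact: is_rderive_rderivable (is_rderive_linear _ _ flin).
rewrite (_ : rderive v f = fun=> f v); first exact: smooth_cst.
by apply/funext => x; exact/is_rderiveE/is_rderive_linear.
Qed.

Lemma smooth_affine (A L : E -> E) f : continuous A ->
  (forall y t w, A (y + t%:C *: w) = A y + t%:C *: L w) ->
  smooth_on setT f -> smooth_on setT (f \o A).
Proof.
move=> Ac AL fs m; elim: m f fs => [|m IH] f fs.
  by split=> [x _|//]; exact: (continuous_comp (Ac x) (smooth_on_continuous fs I)).
split=> [x _|v]; first exact: (continuous_comp (Ac x) (smooth_on_continuous fs I)).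
have h x : is_rderive (f \o A) x v (rderive (L v) f (A x)).
  exact/(is_rderive_affine AL)/rderivableP/(smooth_on_rderivable _ fs I).
split=> [x _|]; first exact: is_rderive_rderivable (h x).
rewrite (_ : rderive v (f \o A) = rderive (L v) f \o A).
  by apply: IH; exact: smooth_on_rderive.
by apply/funext => x; exact/is_rderiveE.
Qed.

Lemma smooth_Re_coord (j : 'I_n) : smooth_on setT (fun z : E => (Re (z 0 j))%:C).
Proof.
apply: smooth_linear => [z|y t w].
  have h := continuous_comp (@coord_continuous _ 1 n 0 j z) (@Re_continuous R _).
  exact: (continuous_comp h (@real_complex_continuous R _)).
by rewrite !mxE cReD cReM/= mul0r subr0 rmorphD rmorphM.
Qed.

End RealDerivatives.

(** * Primitives of closed one-forms and the Cauchy-Riemann argument *)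

Section ClosedOneForms.
Variables (R : realType) (n : nat).
Local Notation E := 'rV[R[i]]_n.
Local Notation mu := (@lebesgue_measure R).

Lemma is_rderive0_cst (f : E -> R[i]) x y :
  (forall z v, is_rderive f z v 0) -> f x = f y.
Proof.
move=> f0; apply/eqP; rewrite eq_complex; apply/andP; split; apply/eqP.
  by apply: (@line_derive_eq0 R n (fun z => Re (f z))) => z v; case: (f0 z v).
by apply: (@line_derive_eq0 R n (fun z => Im (f z))) => z v; case: (f0 z v).
Qed.

Lemma is_rderiveB (f g : E -> R[i]) x v d e : is_rderive f x v d ->
  is_rderive g x v e -> is_rderive (fun z => f z - g z) x v (d - e).
Proof.
move=> hf [g1 g2].
have hg : is_rderive (fun z => - g z) x v (- e).
  rewrite /is_rderive /line_derive in g1 g2 *.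
  split.
    rewrite (_ : Re (- e) = - Re e); last by case: (e).
    rewrite (_ : (fun t : R => Re (- g (x + t%:C *: v))) =
      - (fun t : R => Re (g (x + t%:C *: v)))); first exact: is_deriveN.
    by apply/funext => t; rewrite fctE; case: (g _).
  rewrite (_ : Im (- e) = - Im e); last by case: (e).
  rewrite (_ : (fun t : R => Im (- g (x + t%:C *: v))) =
    - (fun t : R => Im (g (x + t%:C *: v)))); first exact: is_deriveN.
  by apply/funext => t; rewrite fctE; case: (g _).
exact: is_rderiveD hf hg.
Qed.

(** The primitive integrates [theta] along the segment from 0 to [z]. Since [theta] is linear over
    the reals, its real and imaginary parts are handled separately by [poincare_line]. *)
Lemma poincare (theta : E -> E -> R[i]) :
  (forall v, smooth_on setT (theta ^~ v)) ->
  (forall z (t : R) u w, theta z (t%:C *: u + w) = t%:C * theta z u + theta z w) ->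
  (forall z u w, rderive u (theta ^~ w) z = rderive w (theta ^~ u) z) ->
  exists F : E -> R[i], forall z v, is_rderive F z v (theta z v).
Proof.
move=> ts tlin tsym.
exists (fun z => \int[mu]_(t in `[0, 1]) Re (theta (t%:C *: z) z) +i*
                 \int[mu]_(t in `[0, 1]) Im (theta (t%:C *: z) z)).
have d x u w : is_rderive (theta ^~ w) x u (rderive u (theta ^~ w) x).
  exact/rderivableP/(smooth_on_rderivable _ (ts w)).
have tc w x : {for x, continuous (theta ^~ w)}.
  exact: (smooth_on_continuous (ts w) I).
have rc u w x : {for x, continuous (rderive u (theta ^~ w))}.
  exact: (smooth_on_continuous (smooth_on_rderive u (ts w)) I).
move=> z v; split => /=.
  apply: (@poincare_line R n (fun z v => Re (theta z v))
    (fun z u w => Re (rderive u (theta ^~ w) z))).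
  - by move=> x u w; case: (d x u w).
  - by move=> x t u w; rewrite tlin cReD cReM/= mul0r subr0.
  - by move=> x u w; rewrite tsym.
  - by move=> w x; exact: (continuous_comp (tc w x) (@Re_continuous R _)).
  - by move=> u w x; exact: (continuous_comp (rc u w x) (@Re_continuous R _)).
apply: (@poincare_line R n (fun z v => Im (theta z v))
  (fun z u w => Im (rderive u (theta ^~ w) z))).
- by move=> x u w; case: (d x u w).
- by move=> x t u w; rewrite tlin cImD cImM/= mul0r addr0.
- by move=> x u w; rewrite tsym.
- by move=> w x; exact: (continuous_comp (tc w x) (@Im_continuous R _)).
- by move=> u w x; exact: (continuous_comp (rc u w x) (@Im_continuous R _)).
Qed.

(** Compatibility of [theta] with multiplication by i in the direction [e] is the Cauchy-Riemann
    system for F along the complex line through [e]. *)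
Lemma no_period (theta : E -> E -> R[i]) (F : E -> R[i]) (e : E) :
  continuous (theta ^~ e) ->
  (forall z, theta z ('i%C *: e) = 'i%C * theta z e) ->
  (forall z v, is_rderive F z v (theta z v)) ->
  (forall k, F ((k + 'i%C) *: e) = F (k *: e)) ->
  (forall k, F ((k + 1) *: e) = F (k *: e) + 1) -> False.
Proof.
move=> tc tC dF Fi F1.
(* At the parameter k = x + iy, F is [P] + i [Q]; [P'] is both the x-derivative of [P] and the
   y-derivative of [Q]. *)
pose pt (x y : R) : E := x%:C *: e + y%:C *: ('i%C *: e).
pose P (x y : R) := Re (F (pt x y)).
pose Q (x y : R) := Im (F (pt x y)).
pose P' (x y : R) := Re (theta (pt x y) e).
have dP x y : is_derive x (1 : R) (P ^~ y) (P' x y).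
  rewrite (_ : P ^~ y = fun t : R => Re (F (y%:C *: ('i%C *: e) + t%:C *: e))).
    apply: (@line_deriveP R n (fun z => Re (F z))).
    by rewrite addrC; case: (dF (pt x y) e).
  by apply/funext => t; rewrite /P /pt addrC.
have dPy x y : is_derive y (1 : R) (P x) (Re (theta (pt x y) ('i%C *: e))).
  apply: (@line_deriveP R n (fun z => Re (F z)) (x%:C *: e)).
  by case: (dF (pt x y) ('i%C *: e)).
have dQ x y : is_derive y (1 : R) (Q x) (P' x y).
  apply: (@line_deriveP R n (fun z => Im (F z)) (x%:C *: e)).
  rewrite /P' (_ : Re (theta _ e) = Im (theta (pt x y) ('i%C *: e))).
    by case: (dF (pt x y) ('i%C *: e)).
  by rewrite tC cImM/= mul0r mul1r add0r.
have ptc : continuous (fun p : R * R => pt p.1 p.2).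
  move=> p; apply: cvgD; apply: cvgZr_tmp; apply: continuous_cvg.
  - exact: real_complex_continuous.
  - exact: cvg_fst.
  - exact: real_complex_continuous.
  - exact: cvg_snd.
have P'c : continuous (fun p : R * R => P' p.1 p.2).
  move=> p; have h := continuous_comp (ptc p) (tc _).
  exact: (continuous_comp h (@Re_continuous R _)).
have Pc x : continuous (P x).
  move=> y; apply/differentiable_continuous/derivable1_diffP.
  by case: (dPy x y).
have P'cy x : continuous (P' x).
  move=> y; have h : continuous_at y (fun y : R => (x, y)).
    by apply: (@cvg_pair _ _ _ _ (nbhs x) (nbhs y) _ _ _ (fun=> x) id);
      [exact: cvg_cst|exact: cvg_id].
  exact: (continuous_comp h (P'c _)).
(* The derivative of the vertical mean of [P] is the integral of the y-derivative of [Q], that is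
   [Q x 1 - Q x 0], which vanishes by the period i. *)
have B0 x : is_derive x (1 : R) (fun x => \int[mu]_(y in `[0, 1]) P x y) 0.
  have := @is_derive_Rintegral01 R P P' x dP Pc P'c.
  rewrite (Rintegral01_FTC (dQ x) (P'cy x)).
  by rewrite /Q /pt scale1r scale0r addr0 -scalerDl Fi subrr.
have := is_derive_0_is_cst 1 0 B0.
(* The horizontal quasi-period makes the mean at x = 1 exceed the mean at x = 0 by 1, against its
   constancy. *)
have -> : \int[mu]_(y in `[0, 1]) P 1 y = \int[mu]_(y in `[0, 1]) (P 0 y + 1).
  apply: eq_Rintegral => y _.
  rewrite /P /pt scale1r scale0r add0r addrC scalerA -[X in _ + X]scale1r.
  by rewrite -scalerDl F1 cReD.
have int1 : \int[mu]_(y in `[0, 1]) (fun=> 1 : R) y = 1.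
  rewrite (@Rintegral01_FTC R (fun=> 1) id (fun t => is_derive_id t 1)).
    by rewrite subr0.
  exact: cst_continuous.
rewrite RintegralD//; [|exact: integrable01|exact/integrable01/cst_continuous].
by rewrite int1 => /eqP; rewrite -subr_eq0 addrAC subrr add0r oner_eq0.
Qed.

End ClosedOneForms.

(** * The deck group *)

Section GaussianIntegers.
Variable R : realType.
Implicit Types (a b c : R[i]).

Definition gauss c := exists m k : int, c = m%:~R +i* k%:~R.

Lemma gauss0 : gauss 0.
Proof. by exists 0, 0. Qed.

Lemma gauss1 : gauss 1.
Proof. by exists 1, 0. Qed.

Lemma gaussi : gauss 'i%C.
Proof. by exists 0, 1. Qed.

Lemma gaussD a b : gauss a -> gauss b -> gauss (a + b).
Proof.
by move=> [m [k ->]] [m' [k' ->]]; exists (m + m'), (k + k'); rewrite !rmorphD.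
Qed.

Lemma gaussN a : gauss a -> gauss (- a).
Proof. by move=> [m [k ->]]; exists (- m), (- k); rewrite !rmorphN. Qed.

Lemma gauss_ReM a b : gauss a -> gauss b -> gauss ((Re a)%:C * b).
Proof.
move=> [m [k ->]] [m' [k' ->]]; exists (m * m'), (m * k').
by rewrite !rmorphM/=; simpc.
Qed.

Lemma gauss_iM a : gauss a -> gauss ('i%C * a).
Proof. by move=> [m [k ->]]; exists (- k), m; rewrite rmorphN/=; simpc. Qed.

Lemma gauss_small c : gauss c -> `|c| < 1 -> c = 0.
Proof.
have int0 (m : int) : `|m%:~R : R| < 1 -> m = 0.
  by rewrite -intr_norm -[1](mulr1z 1) ltr_int; case: m => [[|m]|m].
move=> [m [k ->]] h.
have := le_lt_trans (normc_ge_Re _) h; rewrite ltcR => /int0 ->.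
by have := le_lt_trans (normc_ge_Im _) h; rewrite ltcR => /int0 ->.
Qed.

(** Take a Gaussian integer [a] within 1/2 of the limit point [c], and a second one [b] that is also
    strictly nearer to [c] than [a]. Their distance is below 1, so they coincide, which is absurd
    unless c = a. *)
Lemma gauss_closed : closed [set c | gauss c].
Proof.
move=> c cc.
have h0 : nbhs c (ball c (2%:R^-1)) by apply: nbhsx_ballx; rewrite invr_gt0.
have [a [ga]] := cc _ h0; rewrite -ball_normE/= => ca.
have [-> //|ac] := eqVneq c a.
have h1 : nbhs c (ball c (2%:R^-1) `&` ball c `|c - a|).
  by apply: (filterI h0); apply: nbhsx_ballx; rewrite normr_gt0 subr_eq0.
have [b [gb]] := cc _ h1; rewrite -ball_normE/= => -[cb cba].
have ab : a - b = 0.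
  apply: gauss_small; first exact/gaussD/gaussN.
  rewrite [ltRHS](splitr 1) mul1r (le_lt_trans (ler_distD c _ _))//.
  by rewrite distrC ltrD.
by move/eqP : ab; rewrite subr_eq0 => /eqP ab; rewrite ab ltxx in cba.
Qed.

Lemma gauss_floor c : exists2 a, gauss a &
  0 <= Re (c + a) <= 1 /\ 0 <= Im (c + a) <= 1.
Proof.
have fl (x : R) : 0 <= x + (- Num.floor x)%:~R <= 1.
  rewrite rmorphN/= subr_ge0 floor_le lerBlDl addrC.
  by have := ltW (floorD1_gt x); rewrite intrD addrC mulr1z.
exists ((- Num.floor (Re c))%:~R +i* (- Num.floor (Im c))%:~R).
  by exists (- Num.floor (Re c)), (- Num.floor (Im c)).
by rewrite cReD cImD.
Qed.

End GaussianIntegers.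

(** * The affine action of Gamma on C^3 *)

Section GroupAction.
Variable R : realType.
Local Notation E := 'rV[R[i]]_3.
Implicit Types (a b c : R[i]) (z w v : E).

Definition vec3 a b c : E := \row_(j < 3) nth 0 [:: a; b; c] j.

Lemma vec3E a b c :
  (vec3 a b c 0 0 = a) * (vec3 a b c 0 1 = b) * (vec3 a b c 0 2 = c).
Proof. by rewrite !mxE. Qed.

Lemma rV3P z w :
  z 0 0 = w 0 0 -> z 0 1 = w 0 1 -> z 0 2 = w 0 2 -> z = w.
Proof.
move=> h0 h1 h2; apply/rowP => -[[|[|[|//]]] jlt].
- by rewrite (_ : Ordinal jlt = 0)//; exact: val_inj.
- by rewrite (_ : Ordinal jlt = 1)//; exact: val_inj.
- by rewrite (_ : Ordinal jlt = 2)//; exact: val_inj.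
Qed.

(** The linear part of [deck a b c]. Real parts are taken of the group parameters only, so it is
    complex linear, and it is the differential at every point. *)
Definition ddeck a b v :=
  vec3 (v 0 0) (v 0 1 + (Re a)%:C * v 0 0)
       (v 0 2 + (Re a)%:C * v 0 1 + (Re b)%:C * v 0 0).

(* On real parts this is multiplication by 1 + Re a t + Re b t^2 + Re c t^3 of
   1 + z_0 t + z_1 t^2 + z_2 t^3 modulo t^4, a commutative group. *)
Definition deck a b c z := ddeck a b z + vec3 a b c.

Lemma deckE a b c z :
  (deck a b c z 0 0 = z 0 0 + a) *
  (deck a b c z 0 1 = z 0 1 + (Re a)%:C * z 0 0 + b) *
  (deck a b c z 0 2 = z 0 2 + (Re a)%:C * z 0 1 + (Re b)%:C * z 0 0 + c).
Proof. by rewrite /deck /ddeck !mxE. Qed.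

Lemma ddeck_linear a b : linear (ddeck a b).
Proof. by move=> k v w; apply: rV3P; rewrite !mxE/= ?mxE; ring. Qed.

HB.instance Definition _ a b :=
  GRing.isLinear.Build R[i] E E _ (ddeck a b) (ddeck_linear a b).

Lemma ddeck00 v : ddeck 0 0 v = v.
Proof. by apply: rV3P; rewrite /ddeck vec3E/=; ring. Qed.

Lemma deck_line a b c z k v : deck a b c (z + k *: v) = deck a b c z + k *: ddeck a b v.
Proof. by rewrite /deck linearD linearZ/= addrAC. Qed.

Lemma cReMC (x : R) a : Re (x%:C * a) = x * Re a.
Proof. by rewrite cReM/= mul0r subr0. Qed.

(** The term [(Re a')%:C * a] is not symmetric in [a] and [a']; the asymmetry is purely imaginary
    and is the source of the commutators in the period computation. *)
Lemma deckM a b c a' b' c' z :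
  deck a' b' c' (deck a b c z) =
  deck (a + a') (b + b' + (Re a')%:C * a)
      (c + c' + (Re a')%:C * b + (Re b')%:C * a) z.
Proof.
apply: rV3P; rewrite !deckE ?cReD ?cReMC ?rmorphD ?rmorphM/=; ring.
Qed.

Lemma deck0 z : deck 0 0 0 z = z.
Proof. by apply: rV3P; rewrite !deckE/=; ring. Qed.

Definition same_orbit z w := exists a b c,
  [/\ gauss a, gauss b, gauss c & w = deck a b c z].

Lemma same_orbit_refl z : same_orbit z z.
Proof. by exists 0, 0, 0; split; rewrite ?deck0//; exact: gauss0. Qed.

Lemma same_orbit_trans z w v : same_orbit z w -> same_orbit w v -> same_orbit z v.
Proof.
move=> [a [b [c [ga gb gc ->]]]] [a' [b' [c' [ga' gb' gc' ->]]]].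
rewrite deckM; do 3 eexists; split; last reflexivity;
  by do ?[exact: gauss_ReM | apply: gaussD].
Qed.

Lemma same_orbit_sym z w : same_orbit z w -> same_orbit w z.
Proof.
move=> [a [b [c [ga gb gc ->]]]].
(* The parameters of the inverse, found by making the three parameters in [deckM] vanish one after
   another. *)
pose b' := (Re a)%:C * a - b.
exists (- a), b', ((Re a)%:C * b - (Re b')%:C * a - c).
have gb' : gauss b' by apply: gaussD; [exact: gauss_ReM|exact: gaussN].
split; first exact: gaussN.
- exact: gb'.
- by do ?[exact: gauss_ReM | exact: gaussN | apply: gaussD | apply: gaussN].
rewrite deckM -[LHS]deck0 raddfN/= rmorphN/=; congr deck; rewrite ?/b'; ring.
Qed.

(* The only candidates for a, b and c with [w = deck a b c z]. *)
Definition shift1 z w := w 0 0 - z 0 0.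
Definition shift2 z w := w 0 1 - z 0 1 - (Re (shift1 z w))%:C * z 0 0.
Definition shift3 z w :=
  w 0 2 - z 0 2 - (Re (shift1 z w))%:C * z 0 1 - (Re (shift2 z w))%:C * z 0 0.

Lemma deck_shift z w : deck (shift1 z w) (shift2 z w) (shift3 z w) z = w.
Proof. by apply: rV3P; rewrite !deckE /shift3 /shift2 /shift1; ring. Qed.

Lemma shift_deck a b c z :
  [/\ shift1 z (deck a b c z) = a, shift2 z (deck a b c z) = b &
      shift3 z (deck a b c z) = c].
Proof.
have h1 : shift1 z (deck a b c z) = a by rewrite /shift1 deckE; ring.
have h2 : shift2 z (deck a b c z) = b by rewrite /shift2 h1 deckE; ring.
by split=> //; rewrite /shift3 h1 h2 deckE; ring.
Qed.

Lemma same_orbitP z w : same_orbit z w <->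
  [/\ gauss (shift1 z w), gauss (shift2 z w) & gauss (shift3 z w)].
Proof.
split=> [[a [b [c [ga gb gc ->]]]]|[h1 h2 h3]].
  by have [-> -> ->] := shift_deck a b c z.
exists (shift1 z w), (shift2 z w), (shift3 z w).
by split; rewrite ?deck_shift.
Qed.

(** The action is triangular: once [a] has reduced the first coordinate, [b] only has to correct the
    second one, and then [c] the third. *)
Lemma same_orbit_floor z : exists2 w, same_orbit z w &
  forall j, 0 <= Re (w 0 j) <= 1 /\ 0 <= Im (w 0 j) <= 1.
Proof.
have [a ga ha] := gauss_floor (z 0 0).
have [b gb hb] := gauss_floor (z 0 1 + (Re a)%:C * z 0 0).
have [c gc hc] := gauss_floor (z 0 2 + (Re a)%:C * z 0 1 + (Re b)%:C * z 0 0).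
exists (deck a b c z); first by exists a, b, c.
move=> -[[|[|[|//]]] jlt].
- by rewrite (_ : Ordinal jlt = 0) ?deckE//; exact: val_inj.
- by rewrite (_ : Ordinal jlt = 1) ?deckE//; exact: val_inj.
- by rewrite (_ : Ordinal jlt = 2) ?deckE//; exact: val_inj.
Qed.

End GroupAction.

(** * The nilmanifold *)

(** In the charts below, transition maps and the induced map are locally affine, so their
    differentials are read off with zero remainder. *)
Lemma diff_near_affine (K : numFieldType) (V W : normedModType K) (f : V -> W)
    (L : {linear V -> W}) x :
  continuous L -> (\forall z \near x, f z = f x + L (z - x)) ->
  differentiable f x /\ ('d f x = L :> (V -> W)).
Proof.
move=> Lc fL.
have fo : f \o shift x = cst (f x) + L +o_ (0 : V) id.
  apply/eqaddoP => e e0.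
  have : \forall z \near (0 : V), f (z + x) = f x + L z.
    move: fL; rewrite (near_shift 0 x) /=; apply: filterS => z.
    by rewrite /= subr0 addrK.
  apply: filterS => z /= fz.
  by rewrite !fctE /= fz subrr normr0 mulr_ge0// ltW.
have dfL : 'd f x = L :> (V -> W) by exact: diff_unique.
by split => //; apply/diff_locallyP; rewrite dfL.
Qed.

Section Quotient.
Variable R : realType.
Local Notation E := 'rV[R[i]]_3.

Definition same_orbitb (z w : E) : bool := `[< same_orbit z w >].

Lemma same_orbitb_refl : reflexive same_orbitb.
Proof. by move=> z; apply/asboolP; exact: same_orbit_refl. Qed.

Lemma same_orbitb_sym : symmetric same_orbitb.
Proof. by move=> z w; apply/asboolP/asboolP; exact: same_orbit_sym. Qed.

Lemma same_orbitb_trans : transitive same_orbitb.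
Proof.
by move=> w z v /asboolP zw /asboolP wv; apply/asboolP; exact: same_orbit_trans wv.
Qed.

Canonical same_orbit_equiv :=
  EquivRel same_orbitb same_orbitb_refl same_orbitb_sym same_orbitb_trans.

Definition nilmanifold := quotient_topology {eq_quot same_orbit_equiv}%qT.
HB.instance Definition _ := Topological.on nilmanifold.

Definition proj (z : E) : nilmanifold := (\pi_nilmanifold z)%qT.

End Quotient.

Arguments proj {R}.

(** * Hausdorff property, second countability and compactness of the quotient *)

Section QuotientTopology.
Variable R : realType.
Local Notation E := 'rV[R[i]]_3.
Local Notation X := (nilmanifold R).

Lemma projP (z w : E) : proj z = proj w <-> same_orbit z w.
Proof.
split=> [h|h]; first by apply/asboolP/(@eqmodP _ (same_orbit_equiv R)).
by apply/(@eqmodP _ (same_orbit_equiv R))/asboolP.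
Qed.

Lemma proj_repr (p : X) : proj (repr p) = p.
Proof. exact: reprK. Qed.

Lemma proj_continuous : continuous (@proj R).
Proof. exact: pi_continuous. Qed.

Lemma deck_continuous a b c : continuous (@deck R a b c).
Proof.
have k (j : 'I_3) : continuous (fun z : E => z 0 j) by exact: coord_continuous.
have m (s : R[i]) (j : 'I_3) : continuous (fun z : E => s * z 0 j).
  by move=> w; exact: (cvgM (cvg_cst s) (k j w)).
have e0 : continuous (fun z => deck a b c z 0 0).
  rewrite (_ : (fun _ => _) = fun z : E => z 0 0 + a).
    by move=> w; exact: (cvgD (k 0 w) (cvg_cst a)).
  by apply/funext => z; rewrite deckE.
have e1 : continuous (fun z => deck a b c z 0 1).
  rewrite (_ : (fun _ => _) = fun z : E => z 0 1 + (Re a)%:C * z 0 0 + b).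
    by move=> w; exact: (cvgD (cvgD (k 1 w) (m _ 0 w)) (cvg_cst b)).
  by apply/funext => z; rewrite deckE.
have e2 : continuous (fun z => deck a b c z 0 2).
  rewrite (_ : (fun _ => _) = fun z : E =>
      z 0 2 + (Re a)%:C * z 0 1 + (Re b)%:C * z 0 0 + c).
    by move=> w; exact: (cvgD (cvgD (cvgD (k 2 w) (m _ 1 w)) (m _ 0 w)) (cvg_cst c)).
  by apply/funext => z; rewrite deckE.
move=> w; apply: rV_continuous => -[[|[|[|//]]] jlt].
- by rewrite (_ : Ordinal jlt = 0); [exact: e0|exact: val_inj].
- by rewrite (_ : Ordinal jlt = 1); [exact: e1|exact: val_inj].
- by rewrite (_ : Ordinal jlt = 2); [exact: e2|exact: val_inj].
Qed.

Lemma ddeck_continuous a b : continuous (@ddeck R a b).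
Proof.
move=> z; have := @deck_continuous a b 0 z.
have -> : @deck R a b 0 = fun v => ddeck a b v + vec3 a b 0 by [].
move=> h.
rewrite (_ : @ddeck R a b = fun v => (ddeck a b v + vec3 a b 0) - vec3 a b 0); last first.
  by apply/funext => v; rewrite addrK.
exact: (cvgB h (cvg_cst _)).
Qed.

(** The preimage of the image of [A] is the union of the preimages of [A] under all deck
    transformations, each of them open. *)
Lemma proj_open (A : set E) : open A -> open (proj @` A : set X).
Proof.
move=> oA; rewrite /open/= /quotient_open.
rewrite (_ : _ @^-1` _ = \bigcup_(g in [set g : R[i] * R[i] * R[i] |
    [/\ gauss g.1.1, gauss g.1.2 & gauss g.2]]) (deck g.1.1 g.1.2 g.2 @^-1` A)).
  by apply: bigcup_open => g _; apply: open_comp => // z _; exact: deck_continuous.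
apply/seteqP; split=> [z [w Aw wz]|z [[[a b] c] /= [ga gb gc] Az]].
  have /same_orbit_sym[a [b [c [ga gb gc wE]]]] := (projP w z).1 wz.
  by exists (a, b, c) => //=; rewrite -wE.
by exists (deck a b c z) => //; apply/projP/same_orbit_sym; exists a, b, c.
Qed.

Lemma shift_continuous :
  [/\ continuous (fun p : E * E => shift1 p.1 p.2),
      continuous (fun p : E * E => shift2 p.1 p.2) &
      continuous (fun p : E * E => shift3 p.1 p.2)].
Proof.
have k1 (j : 'I_3) : continuous (fun p : E * E => p.1 0 j).
  by move=> p; exact: (continuous_comp cvg_fst (@coord_continuous _ 1 3 0 j _)).
have k2 (j : 'I_3) : continuous (fun p : E * E => p.2 0 j).
  by move=> p; exact: (continuous_comp cvg_snd (@coord_continuous _ 1 3 0 j _)).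
have m (f : E * E -> R[i]) (j : 'I_3) : continuous f ->
    continuous (fun p => (Re (f p))%:C * p.1 0 j).
  move=> fc p; have h := continuous_comp (fc p) (@Re_continuous R _).
  exact: (cvgM (continuous_comp h (@real_complex_continuous R _)) (k1 j p)).
have d (j : 'I_3) : continuous (fun p : E * E => p.2 0 j - p.1 0 j).
  by move=> p; exact: (cvgB (k2 j p) (k1 j p)).
have s1 : continuous (fun p : E * E => shift1 p.1 p.2) := d 0.
have s2 : continuous (fun p : E * E => shift2 p.1 p.2).
  by move=> p; exact: (cvgB (d 1 p) (m _ 0 s1 p)).
split; [exact: s1|exact: s2|move=> p].
exact: (cvgB (cvgB (d 2 p) (m _ 1 s1 p)) (m _ 0 s2 p)).
Qed.

(** The shifts are continuous in the pair of points, and two points share an orbit exactly when all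
    three lie in the closed set of Gaussian integers. *)
Lemma same_orbit_closed : closed [set p : E * E | same_orbit p.1 p.2].
Proof.
have [s1 s2 s3] := shift_continuous.
rewrite (_ : [set _ | _] = (fun p : E * E => shift1 p.1 p.2) @^-1` [set c | gauss c]
  `&` ((fun p : E * E => shift2 p.1 p.2) @^-1` [set c | gauss c]
  `&` (fun p : E * E => shift3 p.1 p.2) @^-1` [set c | gauss c])); last first.
  apply/seteqP; split=> [p /same_orbitP[]//|p [h1 [h2 h3]]].
  exact/same_orbitP.
have gc := @gauss_closed R.
apply: closedI; first exact: (preimage_closed (fun p _ => s1 p) gc).
apply: closedI; first exact: (preimage_closed (fun p _ => s2 p) gc).
exact: (preimage_closed (fun p _ => s3 p) gc).
Qed.

(** The orbit relation is closed and [proj] is open: a product neighbourhood of two representatives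
    that avoids the relation projects to disjoint open sets. *)
Lemma nilmanifold_hausdorff : hausdorff_space X.
Proof.
rewrite open_hausdorff => p q pq.
have npq : (~` [set p : E * E | same_orbit p.1 p.2]) (repr p, repr q).
  by move=> /= /projP; rewrite !proj_repr; move/eqP; apply/negP.
have /open_nbhs_nbhs :
    open_nbhs (repr p, repr q) (~` [set p : E * E | same_orbit p.1 p.2]).
  by split => //; exact/closed_openC/same_orbit_closed.
move=> [[A B]/= []]; rewrite !nbhsE => -[A' [oA' Ap] A'A] [B' [oB' Bq] B'B] AB.
exists (proj @` A', proj @` B') => /=.
  rewrite !inE; split.
    by exists (repr p) => //; exact: proj_repr.
  by exists (repr q) => //; exact: proj_repr.
split; [exact: proj_open|exact: proj_open|].
apply/eqP/seteqP; split => // x [[z Az zx] [w Bw wx]].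
apply: (AB (z, w)); first by split; [exact: A'A|exact: B'B].
by apply/projP; rewrite zx wx.
Qed.

Lemma nilmanifold_second_countable : @second_countable X.
Proof.
have [B cB [oB nB]] := @rV_second_countable R 3.
exists [set proj @` A | A in B].
  exact: (card_le_trans (card_image_le _ _) cB).
split=> [_ [A BA <-]|p V]; first exact/proj_open/oB.
rewrite -{1}(proj_repr p) => /proj_continuous/nB[A [BA Ap] AV].
exists (proj @` A); last by move=> _ [z Az <-]; exact: AV.
split; first by exists A.
by exists (repr p) => //; exact: proj_repr.
Qed.

Lemma nilmanifold_compact : compact [set: X].
Proof.
pose S := [set c : R[i] | 0 <= Re c <= 1 /\ 0 <= Im c <= 1].
pose K := [set z : E | forall j, S (z ord0 j)].
have -> : [set: X] = proj @` K.
  apply/seteqP; split => // p _.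
  have [w pw wK] := same_orbit_floor (repr p).
  exists w => //; rewrite -[RHS](proj_repr p); exact/projP/same_orbit_sym.
apply: continuous_compact; first exact/continuous_subspaceT/proj_continuous.
exact: (@rV_compact _ 3 (fun=> S) (fun=> @unit_square_compact R)).
Qed.

End QuotientTopology.

(** * The holomorphic atlas of local inverses of the projection *)

Section Charts.
Variable R : realType.
Local Notation E := 'rV[R[i]]_3.
Local Notation X := (nilmanifold R).

(* Small enough for no nontrivial deck transformation to meet it twice. *)
Definition sheet (z : E) : set E := ball z (2^-1 : R[i]).

Lemma sheet_center z : sheet z z.
Proof. by apply: ballxx; rewrite invr_gt0. Qed.

Lemma sheet_open z : open (sheet z).
Proof. exact: ball_open. Qed.

(** Coordinates of two points in a sheet differ by less than 1. By triangularity each parameter is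
    such a difference once the previous ones vanish, so all three are 0. *)
Lemma sheet_inj z w w' : sheet z w -> sheet z w' -> same_orbit w w' -> w = w'.
Proof.
move=> [_ zw] [_ zw'] [a [b [c [ga gb gc w'E]]]].
have d j : `|w' 0 j - w 0 j| < 1.
  have := zw 0 j; have := zw' 0 j; rewrite -!ball_normE/= => h' h.
  rewrite [ltRHS](splitr 1) mul1r (le_lt_trans (ler_distD (z 0 j) _ _))//.
  by rewrite distrC ltrD.
have a0 : a = 0.
  by apply: gauss_small => //; have := d 0; rewrite w'E deckE addrC addrA addNr add0r.
have b0 : b = 0.
  apply: gauss_small => //; have := d 1; rewrite w'E deckE a0/= mul0r addr0.
  by rewrite addrC addrA addNr add0r.
have c0 : c = 0.
  apply: gauss_small => //; have := d 2; rewrite w'E deckE a0 b0/= !mul0r !addr0.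
  by rewrite addrC addrA addNr add0r.
by rewrite w'E a0 b0 c0 deck0.
Qed.

Definition chart_dom (z : E) : set X := proj @` sheet z.

(** The inverse of [proj] on the sheet, with default value [z] off [chart_dom z]. *)
Definition chart (z : E) (p : X) : E := xget z [set w | sheet z w /\ proj w = p].

Lemma chartE z w : sheet z w -> chart z (proj w) = w.
Proof.
move=> zw; apply: xget_unique => // w' [zw' /projP w'w].
exact: sheet_inj zw' zw w'w.
Qed.

Lemma chartP z p : chart_dom z p -> sheet z (chart z p) /\ proj (chart z p) = p.
Proof. by move=> [w zw <-]; rewrite chartE. Qed.

Lemma chart_dom_open z : open (chart_dom z).
Proof. exact/proj_open/sheet_open. Qed.

Lemma chart_continuous z p : chart_dom z p -> {for p, continuous (chart z)}.
Proof.
move=> [w zw <-] V; rewrite (chartE zw) nbhsE => -[V' [oV' V'w] V'V].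
rewrite nbhsE; exists (proj @` (V' `&` sheet z)).
  split; last by exists w.
  by apply: proj_open; apply: openI => //; exact: sheet_open.
by move=> _ [w' [V'w' zw'] <-]; rewrite /= chartE//; exact: V'V.
Qed.

Lemma proj_deck a b c (z : E) : gauss a -> gauss b -> gauss c ->
  proj (deck a b c z) = proj z.
Proof. by move=> ga gb gc; apply/projP/same_orbit_sym; exists a, b, c. Qed.

(** The deck transformation that brings [A x] into the sheet keeps nearby values of [A] there, the
    sheet being open, so the same parameters serve near [x]. *)
Lemma chart_near (A : E -> E) j x : {for x, continuous A} ->
  chart_dom j (proj (A x)) -> exists a b c, [/\ gauss a, gauss b, gauss c &
    \forall z \near x, chart j (proj (A z)) = deck a b c (A z)].
Proof.
move=> Ac [w jw /projP/same_orbit_sym[a [b [c [ga gb gc wE]]]]].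
exists a, b, c; split => //.
have h : {for x, continuous (deck a b c \o A)}.
  exact: (continuous_comp Ac (@deck_continuous R a b c _)).
have nb : nbhs ((deck a b c \o A) x) (sheet j).
  by apply: open_nbhs_nbhs; split; [exact: sheet_open|rewrite /= -wE].
have nx : \forall z \near x, sheet j ((deck a b c \o A) z).
  by move: (h _ nb); rewrite nbhs_simpl; exact.
apply: filterS nx => z jz.
by rewrite -(proj_deck (A z) ga gb gc) chartE.
Qed.

(** Covers transition maps, with [L] the identity, and the induced map, with [L] equal to
    [phi_lift]. *)
Lemma chart_diff (L : {linear E -> E}) j x : continuous L ->
  chart_dom j (proj (L x)) -> exists a b c, [/\ gauss a, gauss b, gauss c,
    chart j (proj (L x)) = deck a b c (L x) &
    differentiable (chart j \o proj \o L) x /\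
    ('d (chart j \o proj \o L) x = ddeck a b \o L :> (E -> E))].
Proof.
move=> Lc jLx.
have [a [b [c [ga gb gc near_deck]]]] := chart_near (Lc x) jLx.
have deckLx := nbhs_singleton near_deck.
exists a, b, c; split; [exact: ga|exact: gb|exact: gc|exact: deckLx|].
have dLc : continuous (ddeck a b \o L).
  by move=> z; exact: (continuous_comp (Lc z) (@ddeck_continuous R a b _)).
apply: (diff_near_affine dLc).
apply: filterS near_deck => z /= ->; rewrite deckLx linearB/= linearB/=.
by rewrite /deck addrAC [ddeck a b (L z) - _]addrC addrA subrr add0r.
Qed.

Lemma transition_differentiable (i j x : E) : sheet i x ->
  chart_dom j (proj x) -> differentiable (chart j \o proj) x.
Proof.
move=> _ jx.
have idc : continuous (idfun : E -> E) by move=> z; exact: cvg_id.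
have [a [b [c [_ _ _ _ [d _]]]]] := @chart_diff idfun j x idc jx.
exact: d.
Qed.

(** Charts are indexed by the centres of their sheets, and the chart at a point is centred at its
    chosen representative. *)
Definition nilmanifold_complex : complex_manifold R 3 :=
  @ComplexManifold R 3 X (@nilmanifold_hausdorff R) (@nilmanifold_second_countable R)
    E chart_dom sheet chart (fun _ => proj)
    chart_dom_open sheet_open
    (fun z p pz => (chartP pz).1)
    (fun z w zw => ex_intro2 _ _ w zw erefl)
    (fun z p pz => (chartP pz).2)
    chartE chart_continuous
    (fun _ w _ => @proj_continuous R w)
    repr
    (fun p => ex_intro2 _ _ (repr p) (sheet_center _) (proj_repr p))
    transition_differentiable.

End Charts.

(** * The period obstruction *)

Section Obstruction.
Variable R : realType.
Local Notation E := 'rV[R[i]]_3.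

Definition phi_lift (z : E) : E := vec3 0 (z 0 0) ('i%C * z 0 0).

Lemma phi_lift_linear : linear phi_lift.
Proof. by move=> k v w; apply: rV3P; rewrite !mxE/= ?mxE; ring. Qed.

HB.instance Definition _ :=
  GRing.isLinear.Build R[i] E E _ phi_lift phi_lift_linear.

(** The reason [phi_lift] descends to the quotient: Gaussian integers are stable under
    multiplication by i, and the first coordinate 0 removes the mixed terms. *)
Lemma phi_lift_deck a b c z :
  phi_lift (deck a b c z) = deck 0 a ('i%C * a) (phi_lift z).
Proof. by apply: rV3P; rewrite !deckE /phi_lift !vec3E ?deckE/=; ring. Qed.

(** [theta] plays the lift of a closed (1, 0)-form, and [theta] + dS1 that of another representative
    of its class; the last hypothesis says that dz_0 minus the pullback of that representative is
    dS2. Being invariant, S1 and S2 contribute no periods. *)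
Lemma no_holomorphic_primitive (theta : E -> E -> R[i]) (S1 S2 : E -> R[i]) :
  (forall v, smooth_on setT (theta ^~ v)) ->
  (forall z (t : R) u w, theta z (t%:C *: u + w) = t%:C * theta z u + theta z w) ->
  (forall z u w, rderive u (theta ^~ w) z = rderive w (theta ^~ u) z) ->
  (forall z u, theta z ('i%C *: u) = 'i%C * theta z u) ->
  (forall a b c z u, gauss a -> gauss b -> gauss c ->
    theta (deck a b c z) (ddeck a b u) = theta z u) ->
  smooth_on setT S1 ->
  (forall a b c z, gauss a -> gauss b -> gauss c -> S1 (deck a b c z) = S1 z) ->
  smooth_on setT S2 ->
  (forall a b c z, gauss a -> gauss b -> gauss c -> S2 (deck a b c z) = S2 z) ->
  (forall z u : E, u 0 0 - (theta (phi_lift z) (phi_lift u) +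
     rderive (phi_lift u) S1 (phi_lift z)) = rderive u S2 z) -> False.
Proof.
move=> ts tlin tsym tC tinv S1s S1inv S2s S2inv key.
have [F dF] := poincare ts tlin tsym.
(* The period of [F]. By invariance of [theta], the difference of [F] after and before a deck
   transformation has zero derivative, so it may be computed at 0. *)
pose rho a b c := F (deck a b c 0) - F 0.
have F_deck a b c z : gauss a -> gauss b -> gauss c ->
    F (deck a b c z) = F z + rho a b c.
  move=> ga gb gc.
  have : F (deck a b c z) - F z = rho a b c.
    apply: (is_rderive0_cst (f := fun y => F (deck a b c y) - F y)) => {}z v.
    rewrite -[0](subrr (theta z v)); apply: is_rderiveB; last exact: dF.
    apply: (@is_rderive_affine R 3 (deck a b c) (ddeck a b)) => [y t w|].
      exact: deck_line.
    by rewrite -(tinv a b c z v ga gb gc).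
  by move=> <-; rewrite addrC subrK.
have rhoM a b c a' b' c' : gauss a -> gauss b -> gauss c ->
    gauss a' -> gauss b' -> gauss c' ->
    rho (a + a') (b + b' + (Re a')%:C * a)
        (c + c' + (Re a')%:C * b + (Re b')%:C * a) = rho a b c + rho a' b' c'.
  move=> ga gb gc ga' gb' gc'.
  rewrite {1}/rho -deckM F_deck//  [F (deck a b c 0)]F_deck//.
  by rewrite -[F 0 + _ + _]addrA [F 0 + _]addrC addrK.
have g0 := @gauss0 R; have g1 := @gauss1 R; have gi := @gaussi R.
have rho_phi : rho 0 1 'i%C = 1.
  (* [D] is constant by [key]. Its values at 0 and at [deck 1 0 0 0] are compared; [phi_lift]
     carries the latter to [deck 0 1 'i%C 0]. *)
  pose D (z : E) := z 0 0 - (F (phi_lift z) + S1 (phi_lift z)) - S2 z.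
  have D0 z v : is_rderive D z v 0.
    rewrite -[0](subrr (rderive v S2 z)); apply: is_rderiveB; last first.
      exact/rderivableP/(smooth_on_rderivable _ S2s).
    rewrite -key; apply: is_rderiveB.
      apply: (@is_rderive_linear R 3 (fun z : E => z 0 0)) => y t w.
      by rewrite !mxE.
    apply: (@is_rderive_affine R 3 phi_lift phi_lift (fun z => F z + S1 z)).
      by move=> y t w; rewrite linearD linearZ.
    apply: is_rderiveD; first exact: dF.
    exact/rderivableP/(smooth_on_rderivable _ S1s).
  have := is_rderive0_cst (deck 1 0 0 0) 0 D0.
  rewrite /D phi_lift_deck deckE mulr1 F_deck// S1inv// S2inv// mxE add0r.
  rewrite linear0 => h.
  have {1}-> : rho 0 1 'i%C = (1 - (F 0 + S1 0) - S2 0) -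
      (1 - (F 0 + rho 0 1 'i%C + S1 0) - S2 0) by ring.
  rewrite h; ring.
have Re1 : (Re (1 : R[i]))%:C = 1 by [].
have Rei : (Re ('i%C : R[i]))%:C = 0 by [].
have Re0 : (Re (0 : R[i]))%:C = 0 by [].
pose simp := (Re0, Re1, Rei, mul0r, mulr0, mul1r, add0r, addr0).
(* The deck transformations (0, i, 0) and (0, 0, i) are the commutators of
   (1, 0, 0) with (i, 0, 0) and with (0, i, 0). *)
have rho_b : rho 0 'i%C 0 = 0.
  have h1 := rhoM 'i%C 0 0 1 0 0 gi g0 g0 g1 g0 g0.
  have h2 := rhoM 1 0 0 'i%C 0 0 g1 g0 g0 gi g0 g0.
  have gi1 : gauss (1 + 'i%C : R[i]) by exact: gaussD.
  have h3 := rhoM (1 + 'i%C) 0 0 0 'i%C 0 gi1 g0 g0 g0 gi g0.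
  move: h1 h2 h3; rewrite !simp [X in rho X]addrC => -> ->.
  by rewrite addrC -[LHS]addr0 => /addrI <-.
have rho_c : rho 0 0 'i%C = 0.
  have h1 := rhoM 0 'i%C 0 1 0 0 g0 gi g0 g1 g0 g0.
  have h2 := rhoM 1 0 0 0 'i%C 0 g1 g0 g0 g0 gi g0.
  have h3 := rhoM 1 'i%C 0 0 0 'i%C g1 gi g0 g0 g0 gi.
  move: h1 h2 h3; rewrite !simp rho_b !simp => -> -> /esym/(canRL (addKr _)).
  by rewrite addNr.
have rho_b1 : rho 0 1 0 = 1.
  by have := rhoM 0 1 0 0 0 'i%C g0 g1 g0 g0 g0 gi; rewrite !simp rho_c rho_phi addr0.
(* [e] spans the z_1-axis, on which [deck 0 b 0] is translation by [b]. *)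
pose e : E := vec3 0 1 0.
have eE b k : deck 0 b 0 (k *: e) = (k + b) *: e.
  by apply: rV3P; rewrite deckE !mxE/=; ring.
apply: (no_period (theta := theta) (F := F) (e := e)).
- by move=> z; exact: (smooth_on_continuous (ts e) I).
- by move=> z; exact: tC.
- exact: dF.
- by move=> k; rewrite -eE F_deck// rho_b addr0.
- by move=> k; rewrite -eE F_deck// rho_b1.
Qed.

End Obstruction.

(** * Forms on the nilmanifold *)

Section Forms.
Variable R : realType.
Local Notation E := 'rV[R[i]]_3.
Local Notation M := (nilmanifold_complex R).

Lemma phi_lift_continuous : continuous (@phi_lift R).
Proof.
have k : continuous (fun z : E => z 0 0) by exact: coord_continuous.
have e0 : continuous (fun z : E => phi_lift z 0 0).
  rewrite (_ : (fun _ => _) = fun=> 0); first exact: cst_continuous.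
  by apply/funext => z; rewrite mxE.
have e1 : continuous (fun z : E => phi_lift z 0 1).
  rewrite (_ : (fun _ => _) = fun z : E => z 0 0); first exact: k.
  by apply/funext => z; rewrite mxE.
have e2 : continuous (fun z : E => phi_lift z 0 2).
  rewrite (_ : (fun _ => _) = fun z : E => 'i%C * z 0 0).
    by move=> z; exact: (cvgM (cvg_cst 'i%C) (k z)).
  by apply/funext => z; rewrite mxE.
move=> w; apply: rV_continuous => -[[|[|[|//]]] jlt].
- by rewrite (_ : Ordinal jlt = 0); [exact: e0|exact: val_inj].
- by rewrite (_ : Ordinal jlt = 1); [exact: e1|exact: val_inj].
- by rewrite (_ : Ordinal jlt = 2); [exact: e2|exact: val_inj].
Qed.

Definition phi (p : M) : M := proj (phi_lift (repr (p : nilmanifold R))).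

Lemma phi_proj (z : E) : phi (proj z) = proj (phi_lift z).
Proof.
have [a [b [c [ga gb gc zE]]]] := (projP _ _).1 (proj_repr (proj z)).
rewrite /phi {2}zE phi_lift_deck; apply/projP.
by exists 0, a, ('i%C * a); split=> //; [exact: gauss0|exact: gauss_iM].
Qed.

Lemma phi_charts j : chart j \o phi \o proj = chart j \o proj \o @phi_lift R.
Proof. by apply/funext => z /=; rewrite phi_proj. Qed.

Lemma phi_holomorphic : holomorphic phi.
Proof.
split=> [|i j x _ jx].
  apply/(@quotient_continuous E {eq_quot same_orbit_equiv R}%qT M phi).
  rewrite (_ : _ \o _ = proj \o @phi_lift R).
    by move=> z; exact: (continuous_comp (@phi_lift_continuous z) (@proj_continuous R _)).
  by apply/funext => z; exact: phi_proj.
change (differentiable (chart j \o phi \o proj) x); rewrite phi_charts.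
have jx' : chart_dom j (proj (phi_lift x)) by rewrite -phi_proj.
by have [a [b [c [_ _ _ _ [d _]]]]] := chart_diff phi_lift_continuous jx'; exact: d.
Qed.

(* The expression at [z] in the chart centred at [z]. *)
Definition lift_form k (w : preform M k) : E -> ('I_k -> E) -> R[i] :=
  fun z v => w z z v.

Lemma form_transition k (w : preform M k) (i j x : E) a b c v :
  smooth_form w -> gauss a -> gauss b -> gauss c ->
  sheet i x -> sheet j (deck a b c x) ->
  w i x v = w j (deck a b c x) (fun s => ddeck a b (v s)).
Proof.
move=> [_ _ _ compat] ga gb gc ix jax.
have dj : chart_dom j (proj x) by exists (deck a b c x); rewrite ?proj_deck.
have e : chart j (proj x) = deck a b c x by rewrite -(proj_deck x ga gb gc) chartE.
have idc : continuous (idfun : E -> E) by move=> z; exact: cvg_id.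
(* [chart_diff] yields some parameters; since a point and its image determine them, [shift_deck]
   identifies them with the given ones. *)
have [a' [b' [c' [_ _ _ e' [_ d]]]]] := @chart_diff R idfun j x idc dj.
move: e'; rewrite /= e => e'.
have [sa sb _] := shift_deck a b c x; have [sa' sb' _] := shift_deck a' b' c' x.
rewrite -e' in sa' sb'.
have aa' : a' = a by rewrite -sa' sa.
have bb' : b' = b by rewrite -sb' sb.
transitivity (w j (chart j (proj x)) (fun s => 'd (chart j \o proj) x (v s))).
  exact: compat ix dj.
rewrite e; congr (w j _ _); apply/funext => s.
change ('d (chart j \o proj \o idfun) x (v s) = ddeck a b (v s)).
by rewrite d /= aa' bb'.
Qed.

Lemma lift_formE k (w : preform M k) i x v : smooth_form w -> sheet i x ->
  w i x v = lift_form w x v.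
Proof.
move=> ws ix.
have x0 : sheet x (deck 0 0 0 x) by rewrite deck0; exact: sheet_center.
rewrite (form_transition v ws (gauss0 R) (gauss0 R) (gauss0 R) ix x0) deck0.
by congr (w x x); apply/funext => s; rewrite ddeck00.
Qed.

Lemma lift_form_deck k (w : preform M k) a b c x v : smooth_form w ->
  gauss a -> gauss b -> gauss c ->
  lift_form w (deck a b c x) (fun s => ddeck a b (v s)) = lift_form w x v.
Proof.
move=> ws ga gb gc; apply/esym.
by apply: form_transition => //; exact: sheet_center.
Qed.

(** The definition evaluates in the chart attached to the image point; deck invariance of the lift
    removes that choice. *)
Lemma pullback_formE k (w : preform M k) i x v : smooth_form w ->
  pullback_form phi w i x v = lift_form w (phi_lift x) (fun s => phi_lift (v s)).
Proof.
move=> ws; pose p := phi (proj x); pose j : E := repr (p : nilmanifold R).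
change (w j (chart j (phi (proj x)))
  (fun s => 'd (chart j \o phi \o proj) x (v s)) =
  lift_form w (phi_lift x) (fun s => phi_lift (v s))).
have dj : chart_dom j (proj (phi_lift x)).
  by rewrite -phi_proj; exact: (mem_chart_at (p : M)).
have [a [b [c [ga gb gc e [_ d]]]]] := chart_diff phi_lift_continuous dj.
rewrite phi_proj phi_charts e.
have jx : sheet j (deck a b c (phi_lift x)) by rewrite -e; exact: (chartP dj).1.
rewrite (lift_formE _ ws jx) -[RHS](lift_form_deck _ _ ws ga gb gc).
by congr lift_form; apply/funext => s; rewrite d.
Qed.

(** The chart moves with [z], but on the sheet of [x] the lift equals the expression in the single
    chart [x]. *)
Lemma lift_form_smooth k (w : preform M k) v : smooth_form w ->
  smooth_on setT (fun z => lift_form w z v).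
Proof.
move=> ws; apply: smooth_local => x; exists (sheet x), (fun z => w x z v).
split; [exact: sheet_open|exact: sheet_center| |].
  by move=> z /[!inE] xz; rewrite -(lift_formE _ ws xz).
by case: ws => _ _ /(_ x v).
Qed.

Lemma ext_deriv_lift k (w : preform M k) i x v : smooth_form w -> sheet i x ->
  ext_deriv (w i) x v = ext_deriv (lift_form w) x v.
Proof.
move=> ws ix; apply: eq_bigr => a _; congr (_ * _).
set v' := fun b => v (fintype.lift a b).
apply: is_rderiveE; apply: (@near_is_rderive R 3 (fun z => lift_form w z v')).
  have : \forall z \near x, sheet i z.
    by apply: open_nbhs_nbhs; split; [exact: sheet_open|exact: ix].
  by apply: filterS => z iz; rewrite (lift_formE _ ws iz).
exact/rderivableP/(smooth_on_rderivable _ (lift_form_smooth v' ws)).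
Qed.

(* All charts being local sections of [proj], one expression serves for all of
   them. *)
Definition descend k (W : E -> ('I_k -> E) -> R[i]) : preform M k := fun _ => W.

Lemma descend_smooth k (W : E -> ('I_k -> E) -> R[i]) :
  (forall x, real_multilinear (W x)) -> (forall x, Defs.alternating (W x)) ->
  (forall v, smooth_on setT (fun z => W z v)) ->
  (forall a b c x v, gauss a -> gauss b -> gauss c ->
    W (deck a b c x) (fun s => ddeck a b (v s)) = W x v) ->
  smooth_form (descend W).
Proof.
move=> Wlin Walt Ws Winv; split=> [i x _|i x _|i v|i j x v ix jx].
- exact: Wlin.
- exact: Walt.
- exact: smooth_on_subset (@subsetT _ _) (Ws v).
have idc : continuous (idfun : E -> E) by move=> z; exact: cvg_id.
have jx' : chart_dom j (proj (idfun x)) := jx.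
have [a [b [c [ga gb gc e [_ d]]]]] := chart_diff idc jx'.
change (W x v = W (chart j (proj x)) (fun s => 'd (chart j \o proj \o idfun) x (v s))).
by rewrite d [chart j _]e /= Winv.
Qed.

End Forms.

(** * The one-forms dz_0 and eta and their cohomology classes *)

Section OneForms.
Variable R : realType.
Local Notation E := 'rV[R[i]]_3.
Local Notation M := (nilmanifold_complex R).
Implicit Types (theta : E -> E -> R[i]) (z u : E).

Definition one_form theta : preform M 1 := descend (fun z v => theta z (v 0)).

Lemma ext_deriv0 (T : E -> ('I_0 -> E) -> R[i]) x (v : 'I_1 -> E) :
  ext_deriv T x v = rderive (v 0) (fun z => T z (fun=> 0)) x.
Proof.
rewrite /ext_deriv big_ord1 expr0 mul1r; congr rderive.
by apply/funext => z; congr T; apply/funext => -[].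
Qed.

Lemma ext_deriv1 theta x (v : 'I_2 -> E) :
  ext_deriv (fun z (v : 'I_1 -> E) => theta z (v 0)) x v =
  rderive (v 0) (theta ^~ (v 1)) x - rderive (v 1) (theta ^~ (v 0)) x.
Proof.
rewrite /ext_deriv !big_ord_recl big_ord0 addr0 expr0 mul1r expr1 mulN1r.
have l1 : fintype.lift ord0 ord0 = 1 :> 'I_2 by exact: val_inj.
have l0 : fintype.lift (1 : 'I_2) 0 = 0 by exact: val_inj.
by rewrite [0 : 'I_1](_ : _ = ord0) ?l1 ?l0//; exact: val_inj.
Qed.

Lemma closed_one_form theta :
  (forall z (t : R) u w, theta z (t%:C *: u + w) = t%:C * theta z u + theta z w) ->
  (forall u, smooth_on setT (theta ^~ u)) ->
  (forall z u w, rderive u (theta ^~ w) z = rderive w (theta ^~ u) z) ->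
  (forall a b c z u, gauss a -> gauss b -> gauss c ->
    theta (deck a b c z) (ddeck a b u) = theta z u) ->
  closed_form (one_form theta).
Proof.
move=> tlin ts tsym tinv; split; last first.
  move=> i x v _; change (ext_deriv (fun z (v : 'I_1 -> E) => theta z (v 0)) x v = 0).
  by rewrite ext_deriv1 tsym subrr.
apply: descend_smooth.
- by move=> x v a t y w; rewrite !ord1/= tlin.
- by move=> x v a b; rewrite !ord1 eqxx.
- by move=> v; exact: ts.
- by move=> a b c x v ga gb gc; exact: tinv.
Qed.

Lemma closed_form_sym (w : preform M 1) z u v : closed_form w ->
  rderive u (fun y => lift_form w y (fun=> v)) z =
  rderive v (fun y => lift_form w y (fun=> u)) z.
Proof.
move=> [ws /(_ z z (fun s => if s == 0 then u else v) (sheet_center z))].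
rewrite (ext_deriv_lift _ ws (sheet_center z)).
rewrite (_ : lift_form w = fun z v => lift_form w z (fun=> v 0)); last first.
  by do 2 apply/funext => ?; congr lift_form; apply/funext => s; rewrite ord1.
by rewrite (ext_deriv1 (fun z u => lift_form w z (fun=> u)))/= => /subr0_eq.
Qed.

Lemma exact_form0 (w : preform M 1) :
  (forall i x v, sheet i x -> w i x v = 0) -> exact_form w.
Proof.
move=> w0; exists (descend (fun _ _ => 0)).
  apply: descend_smooth.
  - by move=> x v [].
  - by move=> x v [].
  - by move=> v; exact: smooth_cst.
  - by [].
move=> i x v ix; rewrite w0//.
change (0 = ext_deriv (fun (_ : E) (_ : 'I_0 -> E) => 0) x v).
by rewrite ext_deriv0; apply/esym/is_rderiveE/is_rderive_cst.
Qed.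

Lemma dR_class_refl (w : preform M 1) : closed_form w -> dR_class w w.
Proof. by move=> wc; split=> //; apply: exact_form0 => i x v _; rewrite subrr. Qed.

Definition dz_form := one_form (fun _ u => u 0 0).

Lemma dz_form_closed : closed_form dz_form.
Proof.
apply: closed_one_form.
- by move=> z t u w; rewrite !mxE.
- by move=> u; exact: smooth_cst.
- by move=> z u w; rewrite !(is_rderiveE (is_rderive_cst _ _ _)).
- by move=> a b c z u _ _ _; rewrite mxE.
Qed.

Lemma wedge1E (I : {ffun 'I_1 -> 'I_3}) (v : 'I_1 -> E) :
  wedge_dz_dzbar 1 I v = v 0 0 (I 0).
Proof. by rewrite /wedge_dz_dzbar det_mx11 mxE. Qed.

Lemma dz_form_filtered : filtered_form 1 dz_form.
Proof.
exists (fun=> dz_form) => [r|i x v _]; last by rewrite big_nat1.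
rewrite -eqn_leq => /eqP <-; split; first exact: dz_form_closed.1.
move=> i x _; exists (fun I => (I 0 == 0)%:R) => v.
rewrite (bigD1 [ffun=> 0])//= wedge1E !ffunE eqxx mul1r big1 ?addr0// => I I0.
rewrite [I 0 == 0](_ : _ = false) ?mul0r//; apply/negbTE.
by apply: contra I0 => /eqP I0; apply/eqP/ffunP => j; rewrite ffunE ord1.
Qed.

(** In degree 1 with p = 1 only the summand r = 1 occurs, and it is a combination of the complex
    linear coordinates dz_j. *)
Lemma filtered1_iM (w : preform M 1) z u : filtered_form 1 w ->
  lift_form w z (fun=> 'i%C *: u) = 'i%C * lift_form w z (fun=> u).
Proof.
move=> [t tpq wt]; rewrite /lift_form !wt ?big_nat1; try exact: sheet_center.
have [_ /(_ z z (sheet_center z))[c ct]] := tpq 1%N isT.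
rewrite !ct mulr_sumr; apply: eq_bigr => I _.
by rewrite !wedge1E mxE mulrCA.
Qed.

(* The differential of
     (Re z_1 - (Re z_0)^2 / 2) - i (Re z_2 - Re z_0 Re z_1 + (Re z_0)^3 / 3). *)
Definition eta z u : R[i] :=
  (Re (u 0 1))%:C - 'i%C * (Re (u 0 2))%:C +
  (Re (z 0 0))%:C * ('i%C * (Re (u 0 1))%:C - (Re (u 0 0))%:C) +
  (Re (z 0 1))%:C * ('i%C * (Re (u 0 0))%:C) +
  (Re (z 0 0))%:C * (Re (z 0 0))%:C * - ('i%C * (Re (u 0 0))%:C).

Definition eta_form := one_form eta.

Lemma eta_form_closed : closed_form eta_form.
Proof.
have X0 := @smooth_Re_coord R 3 0; have X1 := @smooth_Re_coord R 3 1.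
apply: closed_one_form.
- by move=> z t u w; rewrite /eta !mxE !cReD !cReMC !rmorphD !rmorphM/=; ring.
- move=> u; apply: smoothD; last by apply: smoothM; [exact: smoothM|exact: smooth_cst].
  apply: smoothD; last by apply: smoothM; [exact: X1|exact: smooth_cst].
  apply: smoothD; first exact: smooth_cst.
  by apply: smoothM; [exact: X0|exact: smooth_cst].
- have dX (j : 'I_3) z u : is_rderive (fun z : E => (Re (z 0 j))%:C) z u (Re (u 0 j))%:C.
    apply: (@is_rderive_linear R 3 (fun z => (Re (z 0 j))%:C)) => y t w.
    by rewrite !mxE cReD cReMC rmorphD rmorphM.
  (* The derivative is left in the shape produced by the sum and product rules; [ring] then checks
     its symmetry in [u] and [w]. *)
  have d z u w : is_rderive (eta ^~ w) z u
      (0 + ((Re (u 0 0))%:C * ('i%C * (Re (w 0 1))%:C - (Re (w 0 0))%:C) +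
       (Re (z 0 0))%:C * 0) +
       ((Re (u 0 1))%:C * ('i%C * (Re (w 0 0))%:C) + (Re (z 0 1))%:C * 0) +
       (((Re (u 0 0))%:C * (Re (z 0 0))%:C + (Re (z 0 0))%:C * (Re (u 0 0))%:C) *
         - ('i%C * (Re (w 0 0))%:C) + (Re (z 0 0))%:C * (Re (z 0 0))%:C * 0)).
    apply: is_rderiveD; last first.
      apply: is_rderiveM; last exact: is_rderive_cst.
      by apply: is_rderiveM; exact: dX.
    apply: is_rderiveD; last first.
      by apply: is_rderiveM; [exact: dX|exact: is_rderive_cst].
    apply: is_rderiveD; first exact: is_rderive_cst.
    by apply: is_rderiveM; [exact: dX|exact: is_rderive_cst].
  by move=> z u w; rewrite !(is_rderiveE (d _ _ _)); ring.
- move=> a b c z u _ _ _; rewrite /eta !deckE !mxE/= !cReD !cReMC !rmorphD !rmorphM/=.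
  ring.
Qed.

(** First coordinates vanish on the image of [phi_lift], leaving Re u_1 - i Re u_2 with u_2 = i u_1.
    As Re (i c) = - Im c, the two real parts recombine into the holomorphic coordinate. *)
Lemma eta_phi_lift z u : eta (phi_lift z) (phi_lift u) = u 0 0.
Proof.
rewrite /eta /phi_lift !vec3E cReM/= mul0r mul1r sub0r.
rewrite [RHS]complexE rmorphN rmorph0; ring.
Qed.

Lemma pullback_eta i x v : pullback_form (@phi R) eta_form i x v = v 0 0 0.
Proof. by rewrite pullback_formE; [exact: eta_phi_lift|exact: eta_form_closed.1]. Qed.

Lemma lift_form0_phi (s : preform M 0) a b c x : smooth_form s ->
  gauss a -> gauss b -> gauss c ->
  lift_form s (phi_lift (deck a b c x)) (fun=> 0) = lift_form s (phi_lift x) (fun=> 0).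
Proof.
move=> ss ga gb gc; have gia := gauss_iM ga.
rewrite phi_lift_deck -[RHS](lift_form_deck _ _ ss (gauss0 R) ga gia).
by congr lift_form; apply/funext => -[].
Qed.

Lemma lift_form0_deck (s : preform M 0) a b c x : smooth_form s ->
  gauss a -> gauss b -> gauss c ->
  lift_form s (deck a b c x) (fun=> 0) = lift_form s x (fun=> 0).
Proof.
move=> ss ga gb gc; rewrite -[RHS](lift_form_deck _ _ ss ga gb gc).
by congr lift_form; apply/funext => -[].
Qed.

Lemma pullback_class_eta : pullback_dR (@phi R) 1 (dR_class eta_form) = dR_class dz_form.
Proof.
apply/seteqP; split=> [e [w [[ws wc] [s ss ws_eta]] [ec [s' ss' es']]]|e [ec [s ss es]]].
  split=> //.
  (* If w - eta = ds and e minus the pullback of w is ds', then e - dz_0 has as primitive the sum of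
     s' and the pullback of s. *)
  exists (descend (fun x _ => lift_form s' x (fun=> 0) +
                              lift_form s (phi_lift x) (fun=> 0))).
    apply: descend_smooth.
    - by move=> x v [].
    - by move=> x v [].
    - move=> v; apply: smoothD; first exact: lift_form_smooth.
      apply: (smooth_affine (L := @phi_lift R) (@phi_lift_continuous R) _
                (lift_form_smooth _ ss)).
      by move=> y t u; rewrite linearD linearZ.
    - by move=> a b c x v ga gb gc; rewrite lift_form0_deck// lift_form0_phi.
  move=> i x v ix.
  change (e i x v - v 0 0 0 = ext_deriv (fun x (_ : 'I_0 -> E) =>
    lift_form s' x (fun=> 0) + lift_form s (phi_lift x) (fun=> 0)) x v).
  have h1 := es' i x v ix.
  rewrite (ext_deriv_lift _ ss' ix) ext_deriv0 (pullback_formE _ _ _ ws) in h1.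
  pose px := @phi_lift R x; pose pv (s : 'I_1) := phi_lift (v s).
  have h2 := ws_eta px px pv (sheet_center px).
  rewrite (ext_deriv_lift _ ss (sheet_center px)) ext_deriv0 in h2.
  have h3 : eta_form px px pv = v 0 0 0 by exact: eta_phi_lift.
  rewrite h3 in h2; rewrite ext_deriv0.
  have -> : e i x v - v 0 0 0 = (e i x v - lift_form w px pv) +
      (lift_form w px pv - v 0 0 0) by ring.
  apply/esym/is_rderiveE; rewrite h1 [X in _ + X]h2; apply: is_rderiveD.
    exact/rderivableP/(smooth_on_rderivable _ (lift_form_smooth _ ss')).
  have aff y (t : R) u : phi_lift (y + t%:C *: u) = phi_lift y + t%:C *: phi_lift u :> E.
    by rewrite linearD linearZ.
  have ds := rderivableP
    (smooth_on_rderivable (x := px) (pv 0) (lift_form_smooth (fun=> 0) ss) I).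
  exact: (is_rderive_affine aff ds).
(* For the reverse inclusion the representative is [eta_form] itself, whose pullback is exactly
   dz_0. *)
exists eta_form; first exact/dR_class_refl/eta_form_closed.
split=> //; exists s => // i x v ix.
by rewrite pullback_eta; exact: es.
Qed.

Lemma dz_class_not_image (theta : preform M 1) :
  closed_form theta -> filtered_form 1 theta ->
  pullback_dR (@phi R) 1 (dR_class theta) <> dR_class dz_form.
Proof.
move=> tc tf ht.
(* As a member of the image class, dz_0 differs by ds2 from the pullback of some [w] in the class of
   [theta], and [w] differs from [theta] by ds1. *)
have : dR_class dz_form dz_form by exact/dR_class_refl/dz_form_closed.
rewrite -ht => -[w [[ws wc] [s1 ss1 wt]] [_ [s2 ss2 dzw]]].
have ts := tc.1.
apply: (@no_holomorphic_primitive R (fun z u => lift_form theta z (fun=> u))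
  (fun z => lift_form s1 z (fun=> 0)) (fun z => lift_form s2 z (fun=> 0))).
- by move=> v; exact: lift_form_smooth.
- move=> z t u v; have [/(_ z z (sheet_center z) (fun=> v) 0 t u v) h _ _ _] := ts.
  have e y : theta z z [eta (fun=> v) with 0 |-> y] = lift_form theta z (fun=> y).
    by congr (theta z z); apply/funext => j; rewrite /= ord1 eqxx.
  by move: h; rewrite !e.
- by move=> z u v; exact: closed_form_sym.
- by move=> z u; exact: filtered1_iM.
- by move=> a b c z u ga gb gc; exact: (@lift_form_deck R 1 theta a b c z (fun=> u)).
- exact: lift_form_smooth.
- by move=> a b c z ga gb gc; exact: lift_form0_deck.
- exact: lift_form_smooth.
- by move=> a b c z ga gb gc; exact: lift_form0_deck.
move=> z u.
have := dzw z z (fun=> u) (sheet_center z).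
rewrite (ext_deriv_lift _ ss2 (sheet_center z)) ext_deriv0.
rewrite (pullback_formE _ _ _ ws) => <-.
pose pz := @phi_lift R z.
have := wt pz pz (fun=> phi_lift u) (sheet_center pz).
rewrite (ext_deriv_lift _ ss1 (sheet_center pz)) ext_deriv0 => <-.
change (u 0 0 - (lift_form theta pz (fun=> phi_lift u) +
  (lift_form w pz (fun=> phi_lift u) - lift_form theta pz (fun=> phi_lift u))) =
  u 0 0 - lift_form w pz (fun=> phi_lift u)).
by congr (_ - _); rewrite addrC subrK.
Qed.

End OneForms.

(** * Failure of strictness at the class of dz_0 *)

Theorem proposition9 (R : realType) :
  exists (X : complex_manifold R 3) (phi : X -> X),
    [/\ compact [set: X], holomorphic phi &
      exists k p : nat,
        pullback_dR phi k @` hodge_filtration X p k <>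
        hodge_filtration X p k `&`
          (pullback_dR phi k @` dR_cohomology X k)].
Proof.
exists (nilmanifold_complex R), (@phi R); split.
- exact: nilmanifold_compact.
- exact: phi_holomorphic.
exists 1%N, 1%N => eq_im.
have : (hodge_filtration (nilmanifold_complex R) 1 1 `&`
    (pullback_dR (@phi R) 1 @` dR_cohomology (nilmanifold_complex R) 1)) (dR_class (@dz_form R)).
  split.
    by exists (@dz_form R) => //; split; [exact: dz_form_closed|exact: dz_form_filtered].
  exists (dR_class (@eta_form R)); last exact: pullback_class_eta.
  by exists (@eta_form R) => //; exact: eta_form_closed.
rewrite -eq_im => -[_ [theta [tc tf] <-]].
exact: dz_class_not_image.
Qed.
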